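(* Let $\Sigma_3=\{0,1,2\}$. For every integer $i\ge 1$, let $\textsc{RT}_i(3)$ denote the infimum of $\texttt{pexp}_i(w)$ over all infinite words $w\in\Sigma_3^\omega$. Then: \begin{itemize} \item $\textsc{RT}_i(3)=\tfrac{3i}{2}+\tfrac14$ if $i=1$ or $i$ is even; \item $\textsc{RT}_i(3)=\tfrac{3i}{2}+\tfrac16$ if $i$ is odd and $i\ge 3$. \end{itemize}
   Context: A repetition in a word $u$ is a pair of words $p,e$ such that $pe$ is a factor of $u$, $p$ is non-empty, and $e$ is a prefix of $pe$; its period is $|p|$ and its exponent is $|pe|/|p|$. For a real $\alpha$, a word is $\alpha^+$-free if it contains no repetition of exponent strictly greater than $\alpha$. For an infinite word $w$ and an integer $i\ge1$, a product of $i$ factors of $w$ is a word $u_1u_2\cdots u_i$ where each $u_j$ is a (finite) factor of $w$. $\texttt{pexp}_i(w)$ is the smallest real number $r$ such that every product of $i$ factors of $w$ is $r^+$-free. *)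

(* Defs.v *)
From mathcomp Require Export all_boot all_order all_algebra.
From mathcomp Require Export all_classical all_reals ereal.

Set Implicit Arguments.
Unset Strict Implicit.
Unset Printing Implicit Defensive.

Import Order.TTheory GRing.Theory Num.Theory.

Local Open Scope classical_set_scope.
Local Open Scope ring_scope.

Section Words.
Variable T : eqType.
Implicit Types (u p e : seq T) (w : nat -> T).

Definition repetition u p e : Prop :=
  [/\ infix (p ++ e) u, p != [::] & prefix e (p ++ e)].

Definition exponent (R : realType) p e : R :=
  (size (p ++ e))%:R / (size p)%:R.

Definition plus_free (R : realType) (alpha : R) u : Prop :=
  ~ exists p e, repetition u p e /\ alpha < exponent R p e.

(* The empty word (n = 0) counts as a factor. *)
Definition factor w u : Prop :=
  exists m n : nat, u = mkseq (fun k => w (m + k)%N) n.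

Definition factor_product (i : nat) w u : Prop :=
  exists us : seq (seq T),
    [/\ size us = i, forall v, v \in us -> factor w v & u = flatten us].

Definition products_plus_free (R : realType) (i : nat) w (r : R) : Prop :=
  forall u, factor_product i w u -> plus_free r u.

(* The value is +oo when no real r qualifies (e.g. w periodic); otherwise, for i > 0, the
   infimum is attained, so that it is the smallest such r: see pexpP. *)
Definition pexp (R : realType) (i : nat) w : \bar R :=
  ereal_inf [set r%:E | r in [set r : R | products_plus_free i w r]].

Lemma pexp_leP (R : realType) (i : nat) w (r : R) :
  (pexp R i w <= r%:E)%E <-> products_plus_free i w r.
Proof.
split; last by move=> rP; apply: ereal_inf_lbound; exists r.
move=> le_r u uP [p [e [rep lt_r]]]; move: lt_r; apply/negP; rewrite -leNgt.
rewrite -lee_fin; apply: le_trans le_r; apply: le_ereal_inf_tmp => _ [s sP <-].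
rewrite lee_fin leNgt; apply/negP => lt_s.
by apply: (sP u uP); exists p, e.
Qed.

Lemma pexpP (R : realType) (i : nat) w (r : R) :
  pexp R i w = r%:E <->
  products_plus_free i w r /\
  (forall s : R, products_plus_free i w s -> r <= s).
Proof.
split=> [E | [rP rmin]].
  split; first by apply/pexp_leP; rewrite E.
  by move=> s /pexp_leP; rewrite E lee_fin.
apply/eqP; rewrite eq_le; apply/andP; split; first exact/pexp_leP.
by apply: le_ereal_inf_tmp => _ [s sP <-]; rewrite lee_fin; apply: rmin.
Qed.

End Words.

(* RT_i(k), over the alphabet {0, ..., k-1}. *)
Definition RT (R : realType) (i k : nat) : \bar R :=
  ereal_inf (range (fun w : nat -> 'I_k => pexp R i w)).

(* Main.v *)
(* Lower bounds.  If two factors u, v of w are such that uv has period q and length at least 3q,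
   then w has a factor v' with |uv'| = 3q, and (uv')^j uv, (uv')^j u are products of factors of
   w of period q.  A backtracking search shows that every ternary word contains such a pair
   with |uv| >= 13q/4 (for even i), and one with |u| >= 5q/3 (for odd i).

   Upper bounds.  Let d be a word over 7 letters without factors of exponent >= 3/2.  In the
   image of d by a suitable uniform synchronizing code, long repetitions come from repetitions
   of d and have exponent <= 3/2; the factors of exponent > 3/2 have short periods, in finitely
   many conjugacy classes.  For each of these, the length of a concatenation of i factors is
   bounded by a potential on the cyclic shifts of the period.  Dejean's word serves for i = 1. *)
Require Import Defs.
From mathcomp Require Import zify lra.

Set Implicit Arguments.
Unset Strict Implicit.
Unset Printing Implicit Defensive.

Import Order.TTheory GRing.Theory Num.Theory.

(** * Words and periods *)

(** The value 3i/2 is a break-even point. Factors of length at most 3q/2 never push a product of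
    period q beyond 3iq/2, so an excess needs one longer factor; that factor shows a full period,
    hence fixes the cyclic word along which all the other factors are read. This is what leaves only
    finitely many cyclic words to examine. The additive constants come from what remains after
    removing rounds of 3q letters for two factors: 13q/4 letters for the last two factors give 3i/2
    + 1/4, and 5q/3 letters for the last one give 3i/2 + 1/6. For i = 1 the latter is only 5/3,
    while a single factor of exponent 7/4 is already unavoidable; hence the exceptional case. *)

Definition window (T : Type) (w : nat -> T) (p n : nat) : seq T :=
  mkseq (fun k => w (p + k)) n.

(** Shaped like the last clause of [repetition]: for [s = p ++ e] and [q = size p], [drop q s] is
    [e]. *)
Definition periodic (T : eqType) (q : nat) (s : seq T) : bool :=
  prefix (drop q s) s.

Section Periodic.
Variables (T : eqType) (x0 : T).
Implicit Types (s u v : seq T) (us : seq (seq T)).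

Lemma periodic_nth q s n : periodic q s -> q + n < size s ->
  nth x0 s (q + n) = nth x0 s n.
Proof.
move=> /prefixP[t def_s] lt_n; rewrite -nth_drop.
by rewrite [in RHS]def_s nth_cat size_drop; case: ifP => //; lia.
Qed.

Lemma periodicP q s : 0 < q ->
  reflect (s = mkseq (fun n => nth x0 s (n %% q)) (size s)) (periodic q s).
Proof.
move=> q_gt0; apply: (iffP idP) => [per_s | def_s].
  apply: (@eq_from_nth _ x0); rewrite ?size_mkseq // => n.
  elim/ltn_ind: n => n IHn lt_n; rewrite nth_mkseq //.
  case: (ltnP n q) => [lt_nq | le_qn]; first by rewrite modn_small.
  rewrite -{1}(subnKC le_qn) periodic_nth //; last by rewrite subnKC.
  rewrite IHn; [|lia..]; rewrite nth_mkseq; last lia.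
  by congr nth; rewrite -{2}(subnKC le_qn) modnDl.
rewrite /periodic prefixE; apply/eqP/(@eq_from_nth _ x0).
  by rewrite size_take size_drop; case: ifP => //; lia.
move=> n; rewrite size_take size_drop => lt_n.
have {}lt_n: q + n < size s by move: lt_n; case: ifP; lia.
rewrite nth_take ?nth_drop; last lia.
rewrite [in RHS]def_s [in LHS]def_s !nth_mkseq ?modnDl //; lia.
Qed.

Lemma periodic_mkseq q (f : nat -> T) n : 0 < q ->
  periodic q (mkseq (fun k => f (k %% q)) n).
Proof.
move=> q_gt0; apply/periodicP => //; rewrite size_mkseq.
apply: (@eq_from_nth _ x0); rewrite ?size_mkseq // => k lt_k.
rewrite !nth_mkseq ?modn_mod //.
by apply: leq_ltn_trans lt_k; apply: leq_mod.
Qed.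

Lemma periodic_take q n s : 0 < q -> periodic q s -> periodic q (take n s).
Proof.
move=> q_gt0 /(periodicP _ q_gt0) ->; rewrite /mkseq -map_take take_iota.
exact: periodic_mkseq.
Qed.

(* Wrapping around after [k] full periods is what makes a product repeatable. *)
Lemma periodic_pump q k j s : 0 < q -> k * q <= size s -> periodic q s ->
  periodic q (flatten (nseq j (take (k * q) s)) ++ s).
Proof.
move=> q_gt0 le_kq /(periodicP _ q_gt0) def_s.
suff ->: flatten (nseq j (take (k * q) s)) ++ s =
    mkseq (fun n => nth x0 s (n %% q)) (j * (k * q) + size s).
  exact: periodic_mkseq.
elim: j => [|j IHj] //=; rewrite -catA {}IHj mulSn -addnA.
rewrite [mkseq _ (k * q + _)]/mkseq iotaD map_cat; congr cat.
  rewrite [in LHS]def_s /mkseq -map_take take_iota.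
  by congr (map _ (iota _ _)); lia.
rewrite (addnC 0) iotaDl -map_comp;
apply: eq_map => n /=.
by rewrite modnMDl.
Qed.

Lemma periodic_map (T' : eqType) (f : T -> T') q s :
  periodic q s -> periodic q (map f s).
Proof. by rewrite /periodic -map_drop => /prefixP[t {2}->]; rewrite map_cat prefix_prefix. Qed.

End Periodic.

Section Factors.
Variables (T : eqType) (w : nat -> T).
Implicit Types (u v : seq T) (us : seq (seq T)).

Lemma factor_window p n : factor w (window w p n).
Proof. by exists p, n. Qed.

Lemma take_window p n k : k <= n -> take k (window w p n) = window w p k.
Proof. by move=> le_kn; rewrite /window /mkseq -map_take take_iota (minn_idPl le_kn). Qed.

Lemma drop_window p n k : drop k (window w p n) = window w (p + k) (n - k).
Proof.
rewrite /window /mkseq -map_drop drop_iota add0n -{1}(addn0 k) iotaDl -map_comp.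
by apply: eq_map => j /=; rewrite addnA.
Qed.

Lemma factor_take k u : factor w u -> factor w (take k u).
Proof.
case=> p [n ->]; rewrite /window; exists p, (minn k n).
by rewrite /mkseq -map_take take_iota.
Qed.

Lemma factor_drop k u : factor w u -> factor w (drop k u).
Proof. by case=> p [n ->]; rewrite -/(window w p n) drop_window; apply: factor_window. Qed.

Lemma factor_infix u v : infix u v -> factor w v -> factor w u.
Proof.
move=> /infixP[s [t ->]] /(factor_drop (size s)); rewrite drop_size_cat //.
by move=> /(factor_take (size u)); rewrite take_size_cat.
Qed.

(** Cutting a product at both ends truncates its factors, some of them to the empty word. Empty
    words count as factors, so the number of factors is unchanged. *)
Lemma factors_infix x us : (forall v, v \in us -> factor w v) ->
  infix x (flatten us) ->
  exists us', [/\ size us' = size us, forall v, v \in us' -> factor w v &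
                  x = flatten us'].
Proof.
have takeP n vs : (forall v, v \in vs -> factor w v) -> exists us',
    [/\ size us' = size vs, forall v, v \in us' -> factor w v &
        take n (flatten vs) = flatten us'].
  elim: vs n => [|v vs IH] n facP; first by exists [::].
  have [|us' [sz facP' def]] := IH (n - size v).
    by move=> u u_in; apply: facP; rewrite inE u_in orbT.
  exists (take n v :: us'); split=> /= [|u|]; first by rewrite sz.
    rewrite inE => /orP[/eqP ->|]; last exact: facP'.
    by apply: factor_take; apply: facP; rewrite mem_head.
  rewrite -def take_cat; case: ltnP => // lt_n; last by rewrite (take_oversize lt_n).
  by rewrite (eqP (_ : n - size v == 0)) ?take0 ?cats0 // subn_eq0 ltnW.
have dropP n vs : (forall v, v \in vs -> factor w v) -> exists us',
    [/\ size us' = size vs, forall v, v \in us' -> factor w v &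
        drop n (flatten vs) = flatten us'].
  elim: vs n => [|v vs IH] n facP; first by exists [::].
  have [|us' [sz facP' def]] := IH (n - size v).
    by move=> u u_in; apply: facP; rewrite inE u_in orbT.
  exists (drop n v :: us'); split=> /= [|u|]; first by rewrite sz.
    rewrite inE => /orP[/eqP ->|]; last exact: facP'.
    by apply: factor_drop; apply: facP; rewrite mem_head.
  rewrite -def drop_cat; case: ltnP => // lt_n; last by rewrite (drop_oversize lt_n).
  by rewrite (eqP (_ : n - size v == 0)) ?drop0 // subn_eq0 ltnW.
move=> facP /infixP[s [t def_us]].
have [us1 [sz1 facP1 def1]] := dropP (size s) us facP.
have [us2 [sz2 facP2 def2]] := takeP (size x) us1 facP1.
exists us2; split=> //; first by rewrite sz2.
by rewrite -def2 -def1 def_us drop_size_cat // take_size_cat.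
Qed.

End Factors.

(** * Bounds on [RT] in terms of products that are periodic as a whole *)

Section Bounds.
Variables (R : realType) (i k : nat) (r : R).

Lemma RT_ge :
  (forall w : nat -> 'I_k, exists q u,
     [/\ factor_product i w u, 0 < q <= size u, periodic q u &
         (r <= (size u)%:R / q%:R)%R]) ->
  (r%:E <= RT R i k)%E.
Proof.
move=> wP; apply: le_ereal_inf_tmp => _ [w _ <-].
apply: le_ereal_inf_tmp => _ [s sP <-]; rewrite lee_fin leNgt; apply/negP => lt_s.
have [q [u [uP /andP[q_gt0 le_q] per_u le_r]]] := wP w.
apply: (sP u uP); exists (take q u), (drop q u).
rewrite /repetition /exponent cat_take_drop size_takel //; split.
  by split; rewrite ?infix_refl // -size_eq0 size_takel // -lt0n.
exact: lt_le_trans le_r.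
Qed.

(** A repetition inside a product of i factors is itself a product of i factors, by [factors_infix];
    so only products that are entirely periodic need a bound. *)
Lemma RT_le (w : nat -> 'I_k) :
  (forall us q, size us = i -> (forall v, v \in us -> factor w v) -> 0 < q ->
     periodic q (flatten us) -> ((size (flatten us))%:R <= r * q%:R)%R) ->
  (RT R i k <= r%:E)%E.
Proof.
move=> wP; apply: (@le_trans _ _ (pexp R i w)).
  by apply: ereal_inf_lbound; exists w.
apply/pexp_leP => u [us [szus facP ->]] [p [e [[inf_pe p_neq0 pre_e]]]].
apply/negP; rewrite -leNgt /exponent.
have p_gt0: 0 < size p by rewrite lt0n size_eq0.
have [us' [sz' facP' def_pe]] := factors_infix facP inf_pe.
rewrite ler_pdivrMr ?ltr0n // def_pe; apply: wP; rewrite ?sz' //.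
by rewrite -def_pe /periodic drop_size_cat.
Qed.

End Bounds.

(** * Lower bounds *)

Section Search.

(* The word under construction is stored in reverse, so that extending it is a [cons]. *)
Fixpoint search (bad : seq nat -> bool) (n : nat) (r : seq nat) : bool :=
  if bad r then true else
  if n is n'.+1 then
    [&& search bad n' (0 :: r), search bad n' (1 :: r) & search bad n' (2 :: r)]
  else false.

Variables (T : eqType) (w : nat -> T) (h : nat -> T).
Hypothesis h_surj : forall x, [\/ x = h 0, x = h 1 | x = h 2].

(** The letters of [w] after the window select one branch of the tree; as running out of fuel yields
    [false], this branch ends in a bad word. The map [h] allows for a renaming of the letters. *)
Lemma searchP bad n r p : search bad n r -> all (gtn 3) r ->
    window w p (size r) = map h (rev r) ->
  exists r', [/\ bad r', all (gtn 3) r' & window w p (size r') = map h (rev r')].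
Proof.
elim: n r => [|n IHn] r /=; (case: ifP => [bad_r _ | _]; first by exists r) => //.
case/and3P=> s0 s1 s2 lt_r def_r.
have step a : w (p + size r) = h a ->
    window w p (size (a :: r)) = map h (rev (a :: r)).
  by move=> wa; rewrite rev_cons map_rcons -def_r /window mkseqS wa.
by case: (h_surj (w (p + size r))) => /step; apply: IHn => //=.
Qed.

End Search.

(* The tests of the searches branch with [if], as [||] would evaluate both of its sides. *)
Fixpoint quick_prefix (s t : seq nat) : bool :=
  match s, t with
  | [::], _ => true
  | _, [::] => false
  | x :: s', y :: t' => if x == y then quick_prefix s' t' else false
  end.

Fixpoint quick_infix (s t : seq nat) : bool :=
  if quick_prefix s t then true else if t is _ :: t' then quick_infix s t' else false.

Fixpoint lcp (s t : seq nat) : nat :=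
  match s, t with
  | x :: s', y :: t' => if x == y then (lcp s' t').+1 else 0
  | _, _ => 0
  end.

Lemma quick_prefixE s t : quick_prefix s t = prefix s t.
Proof. by elim: s t => [|x s IHs] [|y t] //=; rewrite IHs; case: eqP. Qed.

Lemma quick_infixE s t : quick_infix s t = infix s t.
Proof.
elim: t => [|y t IHt]; first by rewrite /= quick_prefixE; case: s.
by rewrite infix_consl -IHt -quick_prefixE /=; case: (quick_prefix _ _).
Qed.

(* The pairs of factors sought in the lower bounds; [ok] bounds the period and the lengths. *)
Definition conflict (T : eqType) (ok : nat -> nat -> nat -> bool) (w : nat -> T) : Prop :=
  exists q u v, [/\ factor w u, factor w v, 0 < q, ok q (size u) (size v) &
                    periodic q (u ++ v)].

Section ConflictSearch.
Variables (ok : nat -> nat -> nat -> bool).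
Variable find : nat -> seq nat -> nat -> option (seq nat * seq nat).

(* [find q r e] is an unverified heuristic, where [e] is such that the longest factor of
   period [q] ending [rev r] has length [q + e]; [is_conflict] checks its proposals. *)
Definition is_conflict (q : nat) (r ur vr : seq nat) : bool :=
  [&& 0 < q, ok q (size ur) (size vr), quick_infix ur r, quick_infix vr r &
      periodic q (rev ur ++ rev vr)].

(** In the intended calls [t] is [drop q.-1 r], so that [lcp r t'] measures how far back the period
    q extends. Soundness does not rest on this, since [is_conflict] rechecks every proposal. *)
Fixpoint has_conflict (n q : nat) (r t : seq nat) : bool :=
  if t is _ :: t' then
    if n is n'.+1 then
      if (if find q r (lcp r t') is Some (ur, vr) then is_conflict q r ur vr else false)
      then true else has_conflict n' q.+1 r t'
    else false
  else false.

Variables (T : eqType) (w : nat -> T) (h : nat -> T).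

Lemma has_conflictP n q r t p : has_conflict n q r t ->
  window w p (size r) = map h (rev r) -> conflict ok w.
Proof.
move=> + def_r; elim: t n q => [|a t IHt] [|n] q //=.
case: ifP => [+ _ | _]; last exact: IHt.
case: (find _ _ _) => [[ur vr]|] // /and5P[q_gt0 okq inf_u inf_v per].
have facP s : quick_infix s r -> factor w (map h (rev s)).
  rewrite quick_infixE => /infixP[s1 [s2 def]].
  apply: factor_infix (factor_window w p (size r)); rewrite def_r def.
  by rewrite !rev_cat !map_cat -catA; apply/infixP; do 2?eexists.
exists q, (map h (rev ur)), (map h (rev vr)); split; [exact: facP | exact: facP | by [] | |].
  by rewrite !size_map !size_rev.
by rewrite -map_cat; apply: periodic_map.
Qed.

End ConflictSearch.

Definition repeat_to (n : nat) (s : seq nat) : seq nat := flatten (nseq n s).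

(** For a word ending with a square of period q, taking it as both u and v gives |u| = 2q and |uv| =
    4q, which satisfies both [ok_even] and [ok_odd]. *)
Definition square (q : nat) (r : seq nat) := let s := take (2 * q) r in Some (s, s).

Definition ok1 (q a b : nat) := 7 * q <= 4 * a.

Definition find1 (q : nat) (r : seq nat) (e : nat) : option (seq nat * seq nat) :=
  if 3 * q <= 4 * e then Some (take (q + e) r, [::]) else None.

(** The bound on [a] makes the cut of uv after 3q letters fall inside v. *)
Definition ok_even (q a b : nat) := (a <= 3 * q) && (13 * q <= 4 * (a + b)).

(** [P] is the reversed root of the final run, repeated, and [t] is 13q/4 rounded up. Either the run
    is u and its continuation [z] must occur elsewhere, or a suffix of the run, of length [l2], is v
    and the word [x] that precedes it in the periodic pattern must occur elsewhere. Apart from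
    squares, only periods up to 8 are tried. *)
Definition find_even (q : nat) (r : seq nat) (e : nat) : option (seq nat * seq nat) :=
  if q <= e then square q r else
  if 8 < q then None else
  let t := (13 * q + 3) %/ 4 in
  let l := q + e in
  if l + 2 * q < t then None else
  let P := repeat_to 6 (take q r) in
  let z := drop (6 * q - (t - l)) P in
  if quick_infix z r then Some (take l r, z) else
  let fix go n l2 :=
    if n is n'.+1 then
      if l2 < t - 2 * q then None else
      let x := take (t - l2) (drop l2 P) in
      if quick_infix x r then Some (x, take l2 P) else go n' l2.-1
    else None in
  go e.+1 l.

Definition ok_odd (q a b : nat) := [&& 5 * q <= 3 * a, a <= 3 * q & 3 * q <= a + b].

(** Same two proposals as in [find_even], with |u| = [a], which is 5q/3 rounded up, and |v| = [b],
    so that uv has exactly three periods. *)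
Definition find_odd (q : nat) (r : seq nat) (e : nat) : option (seq nat * seq nat) :=
  if q <= e then square q r else
  if 4 < q then None else
  let a := (5 * q + 2) %/ 3 in
  let b := 3 * q - a in
  let l := q + e in
  let P := repeat_to 6 (take q r) in
  let x := take a (drop b P) in
  if (if b <= l then quick_infix x r else false) then Some (x, take b P) else
  let z := drop (6 * q - b) P in
  if (if a <= l then quick_infix z r else false) then Some (take a r, z) else None.

Definition bad ok find r := has_conflict ok find 60 1 r r.

Definition bad_or ok find (pat : seq nat -> bool) r :=
  if pat r then true else bad ok find r.

(** Read forwards, the word ends with xyzxy for three distinct letters; the second search starts
    from 01201, stored in reverse. *)
Definition pat_even (r : seq nat) : bool :=
  if r is y :: x :: z :: y' :: x' :: _ then
    [&& x == x', y == y', x != y, y != z & x != z]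
  else false.

(** Read forwards, the word ends with xyxzx for three distinct letters; the second search starts
    from 01020. *)
Definition pat_odd (r : seq nat) : bool :=
  if r is x :: z :: x' :: y :: x'' :: _ then
    [&& x == x', x == x'', x != y, y != z & x != z]
  else false.

Lemma search1 : search (bad ok1 find1) 60 [::].
Proof. by vm_cast_no_check (erefl true). Qed.
Lemma search_even0 : search (bad_or ok_even find_even pat_even) 60 [::].
Proof. by vm_cast_no_check (erefl true). Qed.
Lemma search_even1 : search (bad ok_even find_even) 120 [:: 1; 0; 2; 1; 0].
Proof. by vm_cast_no_check (erefl true). Qed.
Lemma search_odd0 : search (bad_or ok_odd find_odd pat_odd) 60 [::].
Proof. by vm_cast_no_check (erefl true). Qed.
Lemma search_odd1 : search (bad ok_odd find_odd) 60 [:: 0; 2; 0; 1; 0].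
Proof. by vm_cast_no_check (erefl true). Qed.

Lemma mem3 x y z c : all (gtn 3) [:: x; y; z] -> uniq [:: x; y; z] -> c < 3 ->
  c \in [:: x; y; z].
Proof. by move: x y z c => [|[|[|?]]] [|[|[|?]]] [|[|[|?]]] [|[|[|?]]]. Qed.

Section Lower.
Variable w : nat -> 'I_3.

Let letter (a : nat) : 'I_3 := inord a.

Let letter_surj (z : 'I_3) : [\/ z = letter 0, z = letter 1 | z = letter 2].
Proof.
by case: z => [[|[|[|//]]] lt_z]; [constructor 1 | constructor 2 | constructor 3];
   apply/val_inj; rewrite /= inordK.
Qed.

Lemma conflict1 : conflict ok1 w.
Proof.
have [//|//|r [bad_r _ def_r]] := searchP (w := w) letter_surj (p := 0) search1.
exact: has_conflictP bad_r def_r.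
Qed.

(* Renaming the letters turns the factor found by the first search into the start of the
   second one. *)
Lemma conflict_two_step ok find pat s n :
  search (bad_or ok find pat) 60 [::] -> search (bad ok find) n s ->
  all (gtn 3) s ->
  (forall r, all (gtn 3) r -> pat r -> exists x y z r',
     [/\ r = map (nth 0 [:: x; y; z]) s ++ r', all (gtn 3) [:: x; y; z] &
         uniq [:: x; y; z]]) ->
  conflict ok w.
Proof.
move=> first_search next_search lt_s patP.
have [//|//|r [bad_r lt_r def_r]] := searchP (w := w) letter_surj (p := 0) first_search.
move: bad_r; rewrite /bad_or; case: ifP => [pat_r _ | _ bad_r]; last first.
  exact: has_conflictP bad_r def_r.
have [x [y [z [r' [def_r' lt_xyz uniq_xyz]]]]] := patP r lt_r pat_r.
pose h a := letter (nth 0 [:: x; y; z] a).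
have h_surj c : [\/ c = h 0, c = h 1 | c = h 2].
  have : val c \in [:: x; y; z] by exact: mem3 lt_xyz uniq_xyz (ltn_ord c).
  rewrite !inE => /or3P[] /eqP def_c; [constructor 1 | constructor 2 | constructor 3];
    by apply/val_inj; rewrite /h /letter /= -def_c inordK ?ltn_ord.
(* As [r] is reversed, its tail [r'] spells the start of [w], and the pattern occurs at position
   [size r']. *)
have def_s : window w (size r') (size s) = map h (rev s).
  have := congr1 (drop (size r')) def_r.
  rewrite drop_window add0n def_r' size_cat size_map addnK => ->.
  rewrite rev_cat map_cat drop_size_cat; last by rewrite size_map size_rev.
  by rewrite -map_rev -map_comp.
have [r2 [bad_r2 _ def_r2]] := searchP h_surj next_search lt_s def_s.
exact: has_conflictP bad_r2 def_r2.
Qed.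

Lemma conflict_even : conflict ok_even w.
Proof.
apply: conflict_two_step search_even0 search_even1 _ _ => //.
move=> [|y [|x [|z [|y' [|x' r]]]]] //= /and5P[lty ltx ltz _ _].
case/and5P=> /eqP <- /eqP <- ? ? ?; exists x, y, z, r.
by split; rewrite //= ?ltx ?lty ?ltz // !inE !negb_or; do !(apply/andP; split).
Qed.

Lemma conflict_odd : conflict ok_odd w.
Proof.
apply: conflict_two_step search_odd0 search_odd1 _ _ => //.
move=> [|x [|z [|x' [|y [|x'' r]]]]] //= /and5P[ltx ltz _ lty _].
case/and5P=> /eqP <- /eqP <- ? ? ?; exists x, y, z, r.
by split; rewrite //= ?ltx ?lty ?ltz // !inE !negb_or; do !(apply/andP; split).
Qed.

End Lower.

(** * Lower bounds on [RT], by pumping conflicts *)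

Lemma RT1_ge (R : realType) : ((7 / 4)%R%:E <= RT R 1 3)%E.
Proof.
apply: RT_ge => w; have [q [u [v [facu _ q_gt0 ok_q per]]]] := conflict1 w.
have le_q : 7 * q <= 4 * size u by exact: ok_q.
exists q, u; split.
- by exists [:: u]; split=> // [x|]; rewrite ?inE /= ?cats0 // => /eqP ->.
- by lia.
- by rewrite -(take_size_cat v (erefl (size u))); apply: (periodic_take (w 0) _ q_gt0 per).
rewrite ler_pdivlMr ?ltr0n // mulrAC ler_pdivrMr ?ltr0n //.
by rewrite -!natrM ler_nat; lia.
Qed.

(** With i = 2j + 2, the product (uv')^j uv has length at least 3qj + 13q/4 = q(3i/2 + 1/4). *)
Lemma RT_even_ge (R : realType) i : 0 < i -> ~~ odd i ->
  ((3 * i%:R / 2 + 1 / 4)%R%:E <= RT R i 3)%E.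
Proof.
move=> i_gt0 even_i; apply: RT_ge => w.
have [q [u [v [facu facv q_gt0 /andP[le_u le_uv] per]]]] := conflict_even w.
pose j := i./2.-1; have def_i : i = j * 2 + 2 by rewrite /j; lia.
(* Exactly three periods, so the next copy of u starts at the phase of the first. *)
pose v' := take (3 * q - size u) v.
have def_z : take (3 * q) (u ++ v) = u ++ v'.
  by rewrite take_cat ltnNge le_u.
exists q, (flatten (nseq j (u ++ v')) ++ (u ++ v)); split.
- exists (flatten (nseq j [:: u; v']) ++ [:: u; v]); split.
  + rewrite size_cat size_flatten /shape map_nseq sumn_nseq /=; lia.
  + move=> x; rewrite mem_cat => /orP[/flattenP[s /nseqP[-> _]] | ]; rewrite !inE.
      by case/orP=> /eqP-> //; apply: factor_take.
    by case/orP=> /eqP->.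
  + rewrite flatten_cat /= cats0; congr (_ ++ _).
    by elim: (j) => //= k ->; rewrite catA.
- by rewrite q_gt0 size_cat; move: le_uv; rewrite -size_cat; lia.
- rewrite -def_z; apply: (periodic_pump (w 0) _ q_gt0 _ per).
  by rewrite size_cat; lia.
have sz_v' : size (u ++ v') = 3 * q.
  by rewrite -def_z size_takel // size_cat; lia.
rewrite ler_pdivlMr ?ltr0n // size_cat size_flatten /shape map_nseq sumn_nseq sz_v'.
have : (13 * q%:R <= 4 * (size (u ++ v))%:R :> R)%R.
  by rewrite -!natrM ler_nat size_cat.
by rewrite def_i !natrD !natrM => ?; lra.
Qed.

(** With i = 2j + 1, the product (uv')^j u has length at least 3qj + 5q/3 = q(3i/2 + 1/6). Its
    periodicity comes from that of (uv')^j uv, of which it is a prefix. *)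
Lemma RT_odd_ge (R : realType) i : odd i ->
  ((3 * i%:R / 2 + 1 / 6)%R%:E <= RT R i 3)%E.
Proof.
move=> odd_i; apply: RT_ge => w.
have [q [u [v [facu facv q_gt0 /and3P[le_qu le_u le_uv] per]]]] := conflict_odd w.
pose j := i./2; have def_i : i = j * 2 + 1 by rewrite /j; lia.
pose v' := take (3 * q - size u) v.
have def_z : take (3 * q) (u ++ v) = u ++ v'.
  by rewrite take_cat ltnNge le_u.
have sz_v' : size (u ++ v') = 3 * q.
  by rewrite -def_z size_takel // size_cat; lia.
exists q, (flatten (nseq j (u ++ v')) ++ u); split.
- exists (flatten (nseq j [:: u; v']) ++ [:: u]); split.
  + rewrite size_cat size_flatten /shape map_nseq sumn_nseq /=; lia.
  + move=> x; rewrite mem_cat => /orP[/flattenP[s /nseqP[-> _]] | ]; rewrite !inE.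
      by case/orP=> /eqP-> //; apply: factor_take.
    by move/eqP->.
  + rewrite flatten_cat /= cats0; congr (_ ++ _).
    by elim: (j) => //= k ->; rewrite catA.
- by rewrite q_gt0 size_cat; lia.
- set s := flatten _; have -> : s ++ u = take (size (s ++ u)) (s ++ (u ++ v)).
    by rewrite catA take_size_cat.
  apply: (periodic_take (w 0) _ q_gt0 _); rewrite /s -def_z.
  apply: (periodic_pump (w 0) _ q_gt0 _ per).
  by rewrite size_cat; lia.
rewrite ler_pdivlMr ?ltr0n // size_cat size_flatten /shape map_nseq sumn_nseq sz_v'.
have : (5 * q%:R <= 3 * (size u)%:R :> R)%R by rewrite -!natrM ler_nat.
by rewrite def_i !natrD !natrM => ?; lra.
Qed.

(** * Repetitions in images of uniform codes *)

(** Here [e] is the excess over one period: the factor has length q + e and exponent 1 + e/q. *)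
Definition repeats (w : nat -> nat) (p q e : nat) : Prop :=
  forall j, j < e -> w (p + j) = w (p + q + j).

Definition flat (code : seq (seq nat)) (x : seq nat) : seq nat :=
  flatten (map (nth [::] code) x).

Definition image (code : seq (seq nat)) (m : nat) (v : nat -> nat) (n : nat) : nat :=
  nth 0 (nth [::] code (v (n %/ m))) (n %% m).

Definition uniform (m : nat) (code : seq (seq nat)) : bool :=
  all (fun u => size u == m) code.

(** Distinct code words have at most [c] letters of common prefix. *)
Definition prefixes_differ (c : nat) (code : seq (seq nat)) : bool :=
  uniq (map (take c.+1) code).

Definition suffixes_differ (m c : nat) (code : seq (seq nat)) : bool :=
  uniq (map (drop (m - c.+1)) code).

(* In an image, the prefixes of length [L] of the code words only occur at block
   boundaries. *)
Definition synchronizing (m L : nat) (code : seq (seq nat)) (pairs : seq (seq nat)) : bool :=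
  all (fun x => let W := flat code x in
    all (fun o => all (fun u => ~~ quick_prefix (take L u) (drop o W)) code) (iota 1 m.-1))
  pairs.

Section Image.
Variables (code : seq (seq nat)) (m : nat) (v : nat -> nat).
Hypotheses (m_gt0 : 0 < m) (code_m : uniform m code).
Hypothesis (v_lt : forall n, v n < size code).
Let w := image code m v.

Lemma size_block a : a < size code -> size (nth [::] code a) = m.
Proof. by move=> lt_a; apply/eqP; apply: (allP code_m); apply: mem_nth. Qed.

Lemma image_block t j : j < m -> w (t * m + j) = nth 0 (nth [::] code (v t)) j.
Proof. by move=> lt_j; rewrite /w /image divnMDl // modnMDl divn_small ?modn_small ?addn0. Qed.

Lemma window_block t : window w (t * m) m = nth [::] code (v t).
Proof.
apply: (@eq_from_nth _ 0); first by rewrite size_mkseq size_block.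
by move=> j; rewrite size_mkseq => lt_j; rewrite nth_mkseq // image_block.
Qed.

Lemma size_flat x : all (gtn (size code)) x -> size (flat code x) = size x * m.
Proof.
elim: x => //= a x IHx /andP[lt_a /IHx]; rewrite /flat /= size_cat => ->.
by rewrite size_block.
Qed.

Lemma nth_flat x n : all (gtn (size code)) x -> n < size x * m ->
  nth 0 (flat code x) n = nth 0 (nth [::] code (nth 0 x (n %/ m))) (n %% m).
Proof.
elim: x n => //= a x IHx n /andP[lt_a lt_x]; rewrite /flat /= nth_cat size_block //.
rewrite -/(flat code x); case: (ltnP n m) => [lt_n _ | le_n lt_n].
  by rewrite divn_small ?modn_small.
have -> : n %/ m = ((n - m) %/ m).+1.
  by rewrite -{1}(subnK le_n) divnDr ?dvdnn // divnn m_gt0 addn1.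
have -> : n %% m = (n - m) %% m by rewrite -{1}(subnK le_n) modnDr.
by rewrite IHx //; lia.
Qed.

Lemma letters_window p n : all (gtn (size code)) (window v p n).
Proof. by apply/allP => _ /mapP[j _ ->]; apply: v_lt. Qed.

Lemma window_image p n N : p %% m + n <= N * m ->
  window w p n = take n (drop (p %% m) (flat code (window v (p %/ m) N))).
Proof.
move=> le_n; have szN : size (flat code (window v (p %/ m) N)) = N * m.
  by rewrite size_flat ?letters_window // size_mkseq.
apply: (@eq_from_nth _ 0).
  by rewrite size_mkseq size_takel // size_drop szN; lia.
move=> j; rewrite size_mkseq => lt_j; rewrite nth_mkseq // nth_take // nth_drop.
rewrite nth_flat ?letters_window ?size_mkseq //; last lia.
have lt_jN : (p %% m + j) %/ m < N by rewrite ltn_divLR //; lia.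
rewrite nth_mkseq // /w /image.
by rewrite {1 2}(divn_eq p m) -addnA divnMDl // modnMDl.
Qed.

Section Desubstitution.
Variables (L cp cs : nat) (pairs : seq (seq nat)).
Hypotheses (L_gt0 : 0 < L) (le_Lm : L <= m).
Hypotheses (cp_lt : cp < m) (cs_lt : cs < m).
Hypothesis pairsP : forall p, window v p 2 \in pairs.
Hypotheses (cpP : prefixes_differ cp code) (csP : suffixes_differ m cs code).
Hypothesis syncP : synchronizing m L code pairs.

(** Since L <= m, the window at [p] lies in the image of two consecutive letters, where
    [synchronizing] excludes every nonzero offset. *)
Lemma sync_position p t : window w p L = window w (t * m) L -> p %% m = 0.
Proof.
move=> eq_w; apply/eqP/negPn/negP; rewrite -lt0n => p_gt0.
have lt_p := ltn_pmod p m_gt0.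
have /allP/(_ (p %% m)) := allP syncP _ (pairsP (p %/ m)).
rewrite mem_iota p_gt0 /=; case: (ltnP _ _) => [_ /(_ isT) | ]; last by lia.
move/allP/(_ (nth [::] code (v t)) (mem_nth _ (v_lt t)))/negP; apply.
rewrite quick_prefixE prefixE -window_block take_window // size_mkseq.
by rewrite -window_image ?eq_w //; lia.
Qed.

Lemma prefix_agree a b r : a < size code -> b < size code ->
  (forall j, j < r -> nth 0 (nth [::] code a) j = nth 0 (nth [::] code b) j) ->
  r <= m -> a = b \/ r <= cp.
Proof.
move=> lt_a lt_b agr le_r; case: (leqP r cp) => [|lt_r]; [by right | left].
apply/eqP; rewrite -(nth_uniq [::] _ _ cpP) ?size_map // !(nth_map [::]) //.
apply/eqP/(@eq_from_nth _ 0); first by rewrite !size_takel ?size_block.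
by move=> j; rewrite size_takel ?size_block // => lt_j; rewrite !nth_take //; apply: agr; lia.
Qed.

Lemma suffix_agree a b l : a < size code -> b < size code ->
  (forall j, m - l <= j < m -> nth 0 (nth [::] code a) j = nth 0 (nth [::] code b) j) ->
  a = b \/ l <= cs.
Proof.
move=> lt_a lt_b agr; case: (leqP l cs) => [|lt_l]; [by right | left].
apply/eqP; rewrite -(nth_uniq [::] _ _ csP) ?size_map // !(nth_map [::]) //.
apply/eqP/(@eq_from_nth _ 0); first by rewrite !size_drop !size_block.
by move=> j; rewrite size_drop size_block // => lt_j; rewrite !nth_drop; apply: agr; lia.
Qed.

(** An excess of m - 1 + L letters contains the first L letters of some block; their copy q letters
    further is a block prefix too, so m divides q. Full blocks then repeat as letters. A partial
    block at either end either belongs to equal code words, which extends the repetition of [v], or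
    has at most [cs] letters on the left, [cp] on the right. *)
Lemma desubstitute p q e : repeats w p q e -> m.-1 + L <= e ->
  exists q0 t e0, [/\ q = q0 * m, repeats v t q0 e0 & e <= e0 * m + cp + cs].
Proof.
(* [t1] is the first block boundary at or after [p], [t2] the last at or before [p + e]. *)
move=> rep le_e; pose t1 := (p + m.-1) %/ m; pose t2 := (p + e) %/ m.
have t1_ge : p <= t1 * m.
  by have := divn_eq (p + m.-1) m; have := ltn_pmod (p + m.-1) m_gt0; rewrite -/t1; lia.
have t1_le : t1 * m <= p + m.-1 by apply: leq_trunc_div.
have t2_le : t2 * m <= p + e by apply: leq_trunc_div.
have t2_gt : p + e < t2.+1 * m by rewrite ltn_ceil.
have le_t12 : t1 <= t2 by rewrite leq_divRL //; lia.
have {}rep n : p <= n < p + e -> w n = w (n + q).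
  by move=> /andP[le_pn lt_n]; have := rep (n - p); rewrite subnKC // => ->; [congr w; lia | lia].
have dvd_q : (t1 * m + q) %% m = 0.
  apply: (@sync_position _ t1); apply/eq_in_map => j; rewrite mem_iota /= => lt_j.
  by rewrite [RHS]rep; [congr w; lia | lia].
move: dvd_q; rewrite modnMDl => /eqP/dvdnP[q0 def_q].
have eq_v t : t1 <= t < t2 -> v t = v (t + q0).
  move=> /andP[le_t lt_t].
  have [] // := prefix_agree (v_lt t) (v_lt (t + q0)) _ (leqnn m); last by lia.
  move=> j lt_j; rewrite -!image_block // rep; first by rewrite def_q mulnDl; congr w; lia.
  by nia.
have [t [n [def_t rep_n le_n]]] : exists t n,
    [/\ t + n = t2, repeats v t q0 n & (t1 * m - p) + (t2 - t1) * m <= n * m + cs].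
  have base : repeats v t1 q0 (t2 - t1).
    by move=> j lt_j; rewrite eq_v; [congr v; lia | lia].
  case: (posnP (t1 * m - p)) => [-> | l_gt0].
    by exists t1, (t2 - t1); rewrite subnKC //; split=> //; lia.
  have t1_gt0 : 0 < t1 by case: (t1) l_gt0 => //; lia.
  have def_t1 : t1 * m = t1.-1 * m + m by rewrite -{1}(prednK t1_gt0) mulSn addnC.
  have [eq_t1 | le_l] : v t1.-1 = v (t1.-1 + q0) \/ t1 * m - p <= cs.
  - apply: suffix_agree => // j lt_j; rewrite -!image_block; [|lia..].
    rewrite rep; first by rewrite def_q mulnDl; congr w; lia.
    by nia.
  - exists t1.-1, (t2 - t1).+1; split; [lia | | by lia].
    case=> [|j] lt_j; first by rewrite !addn0.
    by have := base j lt_j; rewrite -!(addSnnS, addnS) -{1}(prednK t1_gt0) => ->;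
      congr v; lia.
  - by exists t1, (t2 - t1); rewrite subnKC //; split=> //; lia.
have def_e : e = (t1 * m - p) + (t2 - t1) * m + (p + e - t2 * m).
  by have := leq_mul le_t12 (leqnn m); rewrite mulnBl; lia.
have [eq_t2 | le_r] : v t2 = v (t2 + q0) \/ p + e - t2 * m <= cp.
- apply: prefix_agree => //; last by lia.
  move=> j lt_j; rewrite -!image_block; [|lia..].
  rewrite rep; first by rewrite def_q mulnDl; congr w; lia.
  by nia.
- exists q0, t, n.+1; split=> // [j|]; last by rewrite mulSn; lia.
  rewrite ltnS leq_eqVlt => /orP[/eqP -> | /rep_n //].
  by rewrite addnAC def_t.
by exists q0, t, n; split=> //; lia.
Qed.

End Desubstitution.
End Image.

(** * Fixed points without large repetitions *)

Fixpoint agree (n : nat) (s t : seq nat) : bool :=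
  if n is n'.+1 then
    match s, t with
    | x :: s', y :: t' => if x == y then agree n' s' t' else false
    | _, _ => false
    end
  else true.

(** Called with [t = drop q s]: at each offset, agreement over [l] letters reveals an excess [l] for
    the period q, and [ok] must then accept the root. *)
Fixpoint scan (n l q : nat) (ok : seq nat -> bool) (s t : seq nat) : bool :=
  if n is n'.+1 then
    (if agree l s t then ok (take q s) else true) && scan n' l q ok (behead s) (behead t)
  else true.

Definition scan_all (m qmax : nat) (lim : nat -> nat) (ok : seq nat -> bool)
    (images : seq (seq nat)) : bool :=
  all (fun q => let l := lim q in
    all (fun s => scan m l q ok s (drop q s)) images) (iota 1 qmax).

Lemma agreeP n s t : n <= size s -> n <= size t ->
  (forall j, j < n -> nth 0 s j = nth 0 t j) -> agree n s t.
Proof.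
elim: n s t => [|n IHn] [|x s] [|y t] //= le_s le_t eq_st.
have /= -> := eq_st 0 isT; rewrite eqxx; apply: IHn => // j lt_j.
exact: (eq_st j.+1).
Qed.

Lemma scanP n l q ok s t o : scan n l q ok s t -> o < n ->
  agree l (drop o s) (drop o t) -> ok (take q (drop o s)).
Proof.
elim: n s t o => // n IHn s t [|o] /= /andP[ok_s ok_n] lt_o.
  by rewrite !drop0 => agr; move: ok_s; rewrite agr.
have dropE u : drop o.+1 u = drop o (behead u) by case: u => //; case: (o).
by rewrite !dropE; apply: IHn.
Qed.

(** Only a candidate set of factors of length N; [closed_language] verifies that the rounds
    sufficed. *)
Fixpoint language (n N m : nat) (code S : seq (seq nat)) : seq (seq nat) :=
  if n is n'.+1 then
    language n' N m code (undup (S ++ flatten (map (fun x => let W := flat code x in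
      map (fun o => take N (drop o W)) (iota 0 m)) S)))
  else S.

Definition closed_language (N m : nat) (code S : seq (seq nat)) : bool :=
  all (fun x => let W := flat code x in
    all (fun o => take N (drop o W) \in S) (iota 0 m)) S.

Section FixedPoint.
Variables (code : seq (seq nat)) (m : nat).

Fixpoint fixed_aux (k n : nat) : nat :=
  if k is k'.+1 then nth 0 (nth [::] code (fixed_aux k' (n %/ m))) (n %% m) else 0.

Definition fixed_point (n : nat) : nat := fixed_aux n n.

Hypotheses (m_gt1 : 1 < m) (code_m : uniform m code).
Hypothesis code_lt : all (all (gtn (size code))) code.
Hypothesis code0 : nth 0 (nth [::] code 0) 0 = 0.
Hypothesis code_gt0 : 0 < size code.

Let m_gt0 : 0 < m. Proof. exact: ltnW. Qed.

(** Fuel [n] is enough because n/m < n; surplus fuel is spent at position 0, where [code0] keeps the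
    letter 0. *)
Lemma fixed_auxE k n : n <= k -> fixed_aux k n = fixed_point n.
Proof.
rewrite /fixed_point; elim/ltn_ind: n k => [[|n]] IHn [|k] //= le_n.
  elim: k {le_n} => [|k IHk] /=; rewrite ?div0n mod0n ?code0 //.
  by rewrite div0n mod0n in IHk; rewrite IHk.
have lt_d : n.+1 %/ m < n.+1 by apply: ltn_Pdiv.
by rewrite !IHn //; lia.
Qed.

Lemma fixed_pointE n : fixed_point n = image code m fixed_point n.
Proof.
rewrite -(fixed_auxE (leqnSn n)) /image /=; congr nth; congr nth.
by apply: fixed_auxE; apply: leq_div.
Qed.

Lemma fixed_point_lt n : fixed_point n < size code.
Proof.
elim/ltn_ind: n => [[|n]] IHn //; rewrite fixed_pointE /image.
have lt_a := IHn _ (ltn_Pdiv m_gt1 (ltn0Sn n)).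
apply: (allP (allP code_lt _ (mem_nth _ lt_a))); apply: mem_nth.
by rewrite (eqP (allP code_m _ (mem_nth _ lt_a))) ltn_mod.
Qed.

Lemma window_fixed_point p n N : p %% m + n <= N * m ->
  window fixed_point p n =
  take n (drop (p %% m) (flat code (window fixed_point (p %/ m) N))).
Proof.
move=> le_n; rewrite -(window_image m_gt0 code_m fixed_point_lt le_n).
by apply: eq_map => j; rewrite fixed_pointE.
Qed.

Lemma closed_languageP N S p : 0 < N -> window fixed_point 0 N \in S ->
  closed_language N m code S -> window fixed_point p N \in S.
Proof.
move=> N_gt0 S0 clS; elim/ltn_ind: p => [[|p]] IHp //.
have lt_m := ltn_pmod p.+1 m_gt0.
(* The length condition follows from (N - 1)(m - 1) >= 0. *)
rewrite (@window_fixed_point _ _ N); last by nia.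
have xS := IHp _ (ltn_Pdiv m_gt1 (ltn0Sn p)).
by apply: (allP (allP clS _ xS)); rewrite mem_iota.
Qed.

End FixedPoint.

Section Scan.
Variables (code : seq (seq nat)) (m : nat) (v : nat -> nat).
Hypotheses (m_gt0 : 0 < m) (code_m : uniform m code).
Hypothesis (v_lt : forall n, v n < size code).
Variables (N qmax : nat) (lim : nat -> nat) (ok : seq nat -> bool) (S : seq (seq nat)).
Hypothesis langS : forall p, window v p N \in S.
Hypothesis scanS : scan_all m qmax lim ok (map (flat code) S).

Lemma scan_image p q : 0 < q <= qmax -> m.-1 + q + lim q <= N * m ->
  repeats (image code m v) p q (lim q) -> ok (window (image code m v) p q).
Proof.
move=> lt_q le_N rep; have lt_m := ltn_pmod p m_gt0.
rewrite (@window_image _ _ _ m_gt0 code_m v_lt _ _ N); last by lia.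
set W := flat _ _; have szW : size W = N * m.
  by rewrite (size_flat code_m) ?letters_window // size_mkseq.
have WS : W \in map (flat code) S by apply: map_f.
have q_in : q \in iota 1 qmax by rewrite mem_iota add1n ltnS.
have scanW := allP (allP (scanS : all _ _) q q_in) W WS.
have nthW j : p %% m + j < N * m -> nth 0 (drop (p %% m) W) j = image code m v (p + j).
  move=> lt_j; transitivity (nth 0 (window (image code m v) p j.+1) j).
    rewrite (@window_image _ _ _ m_gt0 code_m v_lt _ _ N) ?addnS //.
    by rewrite nth_take.
  by rewrite nth_mkseq.
apply: (scanP scanW lt_m); apply: agreeP; rewrite ?size_drop ?szW; [lia | lia |].
move=> j lt_j; have -> : nth 0 (drop (p %% m) (drop q W)) j =
    nth 0 (drop (p %% m) W) (q + j) by rewrite drop_drop !nth_drop addnA.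
by rewrite !nthW; [rewrite rep ?addnA | lia | lia].
Qed.

End Scan.

Section FreeFixedPoint.
Variables (code : seq (seq nat)) (m : nat).
Hypotheses (m_gt1 : 1 < m) (code_m : uniform m code).
Hypothesis code_lt : all (all (gtn (size code))) code.
Hypothesis code0 : nth 0 (nth [::] code 0) 0 = 0.
Hypothesis code_gt0 : 0 < size code.
Let d := fixed_point code m.

Variables (L N : nat) (pairs S : seq (seq nat)).
Hypotheses (L_gt0 : 0 < L) (le_Lm : L <= m).
Hypotheses (pairs0 : window d 0 2 \in pairs) (pairsP : closed_language 2 m code pairs).
Hypotheses (cpP : prefixes_differ 0 code) (csP : suffixes_differ m 0 code).
Hypothesis syncP : synchronizing m L code pairs.

(* No block of a repetition is lost by desubstitution, so that exponents are preserved. *)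
Variables (bad : nat -> nat -> bool) (lim : nat -> nat) (qmax : nat).
Hypothesis bad_scale : forall q e, bad (q * m) (e * m) -> bad q e.
Hypothesis bad_mono : forall q e e', e <= e' -> bad q e -> bad q e'.
Hypothesis bad_lim : forall q e, 0 < q -> bad q e -> lim q <= e.
Hypothesis bad_short : forall q e, e < m.-1 + L -> 0 < q -> bad q e ->
  q <= qmax /\ m.-1 + q + lim q <= N * m.
Hypotheses (N_gt0 : 0 < N) (S0 : window d 0 N \in S) (SP : closed_language N m code S).
Hypothesis scanS : scan_all m qmax lim (fun=> false) (map (flat code) S).

(** Strong induction on the period: a long bad repetition desubstitutes to a bad one of period q/m,
    while a short one has a period within the range of the scan, whose test rejects every root. *)
Lemma fixed_point_free p q e : 0 < q -> repeats d p q e -> ~~ bad q e.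
Proof.
have m_gt0 : 0 < m by apply: ltnW.
have d_lt : forall n, d n < size code by apply: fixed_point_lt.
have pairs_d n : window d n 2 \in pairs by apply: closed_languageP.
have S_d n : window d n N \in S by apply: closed_languageP.
have dE n : d n = image code m d n by apply: fixed_pointE.
elim/ltn_ind: q p e => q IHq p e q_gt0 rep; apply/negP => bad_qe.
have rep' : repeats (image code m d) p q e by move=> j /rep; rewrite !dE.
case: (leqP (m.-1 + L) e) => [le_e | lt_e].
  have [q0 [t [e0 [def_q rep0 le_e0]]]] :=
    desubstitute m_gt0 code_m d_lt L_gt0 le_Lm m_gt0 m_gt0 pairs_d cpP csP syncP rep' le_e.
  have q0_gt0 : 0 < q0 by case: (q0) def_q q_gt0 => // ->.
  have /negP[] : ~~ bad q0 e0 by apply: IHq rep0 => //; rewrite def_q; nia.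
  by apply: bad_scale; rewrite -def_q; apply: bad_mono bad_qe; lia.
have [le_q le_N] := bad_short lt_e q_gt0 bad_qe.
have q_le : 0 < q <= qmax by rewrite q_gt0.
have noscan := scan_image m_gt0 code_m d_lt S_d scanS q_le le_N (p := p).
apply: notF; apply: noscan => j lt_j.
by apply: rep'; apply: leq_trans lt_j (bad_lim q_gt0 bad_qe).
Qed.

End FreeFixedPoint.

(** * Products of factors with a given period *)

Definition cycle_word (c : seq nat) (k l : nat) : seq nat :=
  mkseq (fun n => nth 0 c ((k + n) %% size c)) l.

Fixpoint max_lcp (n : nat) (s t : seq nat) : nat :=
  if n is n'.+1 then maxn (lcp s t) (max_lcp n' s (behead t)) else 0.

(** The comparison word is capped at two periods, so a value below [2 * size c] is a genuine
    maximum. *)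
Definition run_bound (m : nat) (images : seq (seq nat)) (c : seq nat) (k : nat) : nat :=
  let s := cycle_word c k (2 * size c) in
  foldr maxn 0 (map (max_lcp m s) images).

Definition run_bounds m images c : seq nat := mkseq (run_bound m images c) (size c).

Fixpoint best_from (n l : nat) (X : seq nat) : nat :=
  if n is n'.+1 then maxn (2 * l + head 0 X) (best_from n' l.+1 (behead X)) else 0.

(** A Bellman operator in max-plus algebra: the gain of one factor read from phase k, plus the value
    [X] of the phase reached. Lengths count double as the critical mean 3q/2 may be a half-integer;
    with runs shorter than 2q, four copies of [X] cover every index. *)
Definition best (L X : seq nat) : seq nat :=
  let X4 := flatten (nseq 4 X) in
  mkseq (fun k => best_from (nth 0 L k).+1 0 (drop k X4)) (size L).

(** Two rounds of value iteration from the zero potential, less the allowed gain [2 * lam].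
    Truncated subtraction does no harm, since [class_ok] tests the required inequality directly. *)
Definition energy (L : seq nat) (lam : nat) : seq nat :=
  map (subn^~ (2 * lam)) (best L (best L (nseq (size L) 0))).

(* A class [(c, lam)] stands for the cyclic shifts of [c], for which [lam] bounds twice the
   average length of the factors in a long concatenation. *)
Definition class_ok (m : nat) (images : seq (seq nat))
    (final : nat -> nat -> seq nat -> seq nat -> bool) (cl : seq nat * nat) : bool :=
  let: (c, lam) := cl in
  let q := size c in
  let L := run_bounds m images c in
  let E := energy L lam in
  let G := best L E in
  let B := best L G in
  [&& 0 < q, 2 * q <= m, all (gtn (2 * q)) L,
      all (fun k => nth 0 B k <= 2 * lam + nth 0 E k) (iota 0 q) & final q lam E G].

Definition in_class (classes : seq (seq nat * nat)) (y : seq nat) : bool :=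
  has (fun cl => if size cl.1 == size y then quick_infix y (cl.1 ++ cl.1) else false) classes.

Lemma lcp_ge n s t : n <= size s -> n <= size t ->
  (forall j, j < n -> nth 0 s j = nth 0 t j) -> n <= lcp s t.
Proof.
elim: n s t => [|n IHn] [|x s] [|y t] //= le_s le_t eq_st.
have /= -> := eq_st 0 isT; rewrite eqxx; apply: IHn => // j lt_j.
exact: (eq_st j.+1).
Qed.

Lemma max_lcp_ge n s t o : o < n -> lcp s (drop o t) <= max_lcp n s t.
Proof.
elim: n t o => // n IHn t [|o] lt_o /=; first by rewrite drop0 leq_maxl.
apply: leq_trans (leq_maxr _ _); have -> : drop o.+1 t = drop o (behead t).
  by case: t => //; case: (o).
exact: IHn.
Qed.

Lemma foldr_maxn_ge s x : x \in s -> x <= foldr maxn 0 s.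
Proof.
elim: s => //= y s IHs; rewrite inE => /orP[/eqP -> | /IHs le_x].
  exact: leq_maxl.
exact: leq_trans le_x (leq_maxr _ _).
Qed.

Lemma nth_flatten_nseq X j n : n < j * size X ->
  nth 0 (flatten (nseq j X)) n = nth 0 X (n %% size X).
Proof.
elim: j n => //= j IHj n lt_n; rewrite nth_cat.
case: (ltnP n (size X)) => [lt_nX | le_nX]; first by rewrite modn_small.
by rewrite IHj; [rewrite -{2}(subnK le_nX) modnDr | lia].
Qed.

Lemma best_from_ge n l0 X l : l < n -> 2 * (l0 + l) + nth 0 X l <= best_from n l0 X.
Proof.
elim: n l0 X l => // n IHn l0 X [|l] lt_l /=.
  by rewrite addn0 nth0 leq_maxl.
apply: leq_trans (leq_maxr _ _); rewrite addnS -addSn -nth_behead.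
exact: IHn.
Qed.

Lemma size_best L X : size (best L X) = size L.
Proof. by rewrite size_mkseq. Qed.

Lemma best_ge L X k l : size X = size L -> k < size L -> nth 0 L k < 2 * size L ->
  l <= nth 0 L k -> 2 * l + nth 0 X ((k + l) %% size L) <= nth 0 (best L X) k.
Proof.
move=> szX lt_k lt_L le_l; rewrite nth_mkseq // -szX -(@nth_flatten_nseq X 4); last lia.
by rewrite -nth_drop -{1}(add0n l) best_from_ge.
Qed.

Section Classes.
Variables (code : seq (seq nat)) (m : nat) (v : nat -> nat).
Hypotheses (m_gt0 : 0 < m) (code_m : uniform m code).
Hypothesis (v_lt : forall n, v n < size code).
Let w := image code m v.
Variable pairs : seq (seq nat).
Hypothesis pairsP : forall p, window v p 2 \in pairs.

(** The first min(l, 2q) letters fit in the image of two letters, as 2q <= m, so they are seen by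
    [run_bound]; since that value is below 2q, the minimum is l. *)
Lemma run_boundP c k p l : 2 * size c <= m ->
  run_bound m (map (flat code) pairs) c k < 2 * size c ->
  window w p l = cycle_word c k l -> l <= run_bound m (map (flat code) pairs) c k.
Proof.
move=> le_c lt_run def_u; set q2 := 2 * size c in le_c lt_run.
have lt_m := ltn_pmod p m_gt0.
suff le_min : minn l q2 <= run_bound m (map (flat code) pairs) c k by lia.
have WS : flat code (window v (p %/ m) 2) \in map (flat code) pairs by apply: map_f.
apply: leq_trans (foldr_maxn_ge (map_f _ WS)); apply: leq_trans (max_lcp_ge _ _ lt_m).
have le_lq : minn l q2 <= l /\ minn l q2 <= q2 by lia.
apply: lcp_ge; first by rewrite size_mkseq; lia.
  by rewrite size_drop (size_flat code_m) ?letters_window // size_mkseq; lia.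
move=> j lt_j; have := congr1 (nth 0 ^~ j) def_u.
rewrite !nth_mkseq; try lia; move=> <-.
transitivity (nth 0 (window w p (minn l q2)) j); first by rewrite nth_mkseq.
rewrite (@window_image _ _ _ m_gt0 code_m v_lt _ _ 2); last by lia.
by rewrite nth_take.
Qed.

Section OneClass.
Variables (final : nat -> nat -> seq nat -> seq nat -> bool) (c : seq nat) (lam : nat).
Hypothesis cP : class_ok m (map (flat code) pairs) final (c, lam).
Let q := size c.
Let L := run_bounds m (map (flat code) pairs) c.
Let E := energy L lam.
Let G := best L E.

(* [E] and [G] are potentials on the phases of [c], for an even and an odd number of
   remaining factors respectively: the sum telescopes two factors at a time. *)
Lemma product_bound (us : seq (seq nat)) k : k < q -> (forall u, u \in us -> factor w u) ->
  flatten us = cycle_word c k (size (flatten us)) ->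
  if odd (size us) then 2 * size (flatten us) + lam <= lam * size us + nth 0 G k
  else 2 * size (flatten us) <= lam * size us + nth 0 E k.
Proof.
case/and5P: cP => q_gt0 le_qm /allP ltL /allP BP _.
have szL : size L = q by rewrite size_mkseq.
have szE : size E = size L by rewrite size_map size_best.
have szG : size G = size L by rewrite size_best.
elim: us k => [|u us IHus] k lt_k facP def_us; first by rewrite muln0.
have lt_Lk : nth 0 L k < 2 * size L by rewrite szL; apply: ltL; rewrite mem_nth ?szL.
have le_u : size u <= nth 0 L k.
  have [p [n def_u]] := facP u (mem_head _ _).
  rewrite nth_mkseq //; apply: (@run_boundP _ _ p) => //.
    by move: lt_Lk; rewrite nth_mkseq // szL.
  have -> : window w p (size u) = u by rewrite def_u size_mkseq.
  have := congr1 (take (size u)) def_us.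
  rewrite /= take_size_cat // size_cat /cycle_word /mkseq -map_take take_iota.
  by rewrite (minn_idPl (leq_addr _ _)).
pose k' := (k + size u) %% q.
have lt_k' : k' < q by apply: ltn_pmod.
have def_us' : flatten us = cycle_word c k' (size (flatten us)).
  have := congr1 (drop (size u)) def_us.
  rewrite /= drop_size_cat // size_cat /cycle_word /mkseq -map_drop drop_iota add0n.
  rewrite addKn -{1}(addn0 (size u)) iotaDl -map_comp => {1}->.
  by apply: eq_map => j /=; rewrite /k' modnDml addnA.
have facP' x : x \in us -> factor w x by move=> x_in; apply: facP; rewrite inE x_in orbT.
have := IHus k' lt_k' facP' def_us'.
(* [leG] adds a factor to an even number of them, [leB] to an odd number; the latter returns to [E]
   through [le_BE], at the cost [2 * lam]. *)
have := best_ge szE (_ : k < size L) lt_Lk le_u; rewrite szL => /(_ lt_k) leG.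
have := best_ge szG (_ : k < size L) lt_Lk le_u; rewrite szL => /(_ lt_k) leB.
have := BP k; rewrite mem_iota => /(_ lt_k); rewrite -/L -/E -/G => le_BE.
rewrite /= size_cat mulnS -/G; rewrite -/k' -/G in leG leB *; case: (odd (size us)) => /=. all: lia.
Qed.

End OneClass.

Variables (final : nat -> nat -> seq nat -> seq nat -> bool).
Variable classes : seq (seq nat * nat).
Hypothesis classesP : all (class_ok m (map (flat code) pairs) final) classes.
Hypothesis long_runs : forall p q e, 0 < q -> q < 2 * e -> repeats w p q e ->
  in_class classes (window w p q).

(** If no factor exceeds 3q/2, the first bound is immediate. Otherwise [long_runs] puts the root of
    a long factor in a class, and the period q spreads this to the whole product, so [product_bound]
    applies. *)
Lemma product_cases (us : seq (seq nat)) q : 0 < q -> (forall u, u \in us -> factor w u) ->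
  periodic q (flatten us) ->
  2 * size (flatten us) <= 3 * q * size us \/
  exists lam E G x, final q lam E G /\
    if odd (size us) then x \in G /\ 2 * size (flatten us) + lam <= lam * size us + x
    else x \in E /\ 2 * size (flatten us) <= lam * size us + x.
Proof.
move=> q_gt0 facP per.
have [short | /allPn[u u_in /negbTE long]] := boolP (all (fun u => 2 * size u <= 3 * q) us).
  left; elim: (us) short => [|u us' IHus] /=; first by rewrite muln0.
  by case/andP=> le_u /IHus le_us; rewrite size_cat; lia.
have {}long : 3 * q < 2 * size u by rewrite ltnNge long.
right; case/splitPr: u_in per facP => us1 us2 per facP.
set us' := us1 ++ _ in per facP *; set s := flatten us' in per *.
have def_s : s = flatten us1 ++ u ++ flatten us2 by rewrite /s flatten_cat.
have [p [n def_u]] : factor w u by apply: facP; rewrite mem_cat mem_head orbT.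
have size_u : size u = n by rewrite def_u size_mkseq.
set o := size (flatten us1).
have nth_s j : j < n -> nth 0 s (o + j) = w (p + j).
  move=> lt_j; rewrite def_s nth_cat ltnNge leq_addr addKn nth_cat size_u lt_j.
  by rewrite def_u nth_mkseq.
have size_s : o + n <= size s by rewrite def_s !size_cat size_u addnA leq_addr.
have rep : repeats w p q (n - q).
  move=> j lt_j; rewrite -addnA -!nth_s; [|lia..].
  by rewrite addnCA (periodic_nth _ per) //; lia.
have long_e : q < 2 * (n - q) by rewrite -size_u; lia.
have /hasP[[c lam] cl_in] := long_runs q_gt0 long_e rep.
rewrite size_mkseq /=; case: eqP => // size_c; rewrite quick_infixE.
move/infixP; set y := window w p q => inf_y.
have {inf_y} [k nth_y] : exists k, forall j, j < q -> nth 0 y j = nth 0 c ((k + j) %% q).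
  case: inf_y => [s1 [s2 def_cc]]; exists (size s1) => j lt_j.
  have size_y : size y = q by rewrite size_mkseq.
  have := congr1 size def_cc; rewrite !size_cat size_y size_c => size_cc.
  have lt_2q : size s1 + j < 2 * size c by rewrite size_c; lia.
  have := nth_flatten_nseq lt_2q; rewrite /= cats0 size_c => <-.
  by rewrite def_cc nth_cat ltnNge leq_addr addKn nth_cat size_y lt_j.
have cP := allP classesP _ cl_in.
(* The long factor starts at offset [o] and phase [k], so the product starts at phase k - o modulo
   q. *)
pose k' := (k + (q - o %% q)) %% q.
have lt_k' : k' < q by apply: ltn_pmod.
have def_cyc : flatten us' = cycle_word c k' (size (flatten us')).
  apply: (@eq_from_nth _ 0); first by rewrite size_mkseq.
  rewrite -/s => i lt_i; rewrite nth_mkseq // size_c.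
  pose j := (i + (q - o %% q)) %% q; have lt_j : j < q by apply: ltn_pmod.
  have eq_mod : (o + j) %% q = i %% q.
    have le_o : o %% q <= q by apply/ltnW/ltn_pmod.
    by rewrite modnDmr -modnDml addnCA subnKC // modnDr.
  have nth_mod a : a < size s -> nth 0 s a = nth 0 s (a %% q).
    by move=> lt_a; rewrite {1}(elimT (periodicP 0 _ q_gt0) per) nth_mkseq.
  rewrite nth_mod // -eq_mod -nth_mod; last by lia.
  rewrite nth_s; last by lia.
  have := nth_y j lt_j; rewrite nth_mkseq // => ->.
  by rewrite /k' /j modnDmr modnDml addnA addnAC.
have := product_bound cP; rewrite /= size_c => /(_ us' k' lt_k' facP def_cyc).
case/and5P: (cP) => c_gt0 _ _ _; rewrite size_c => fin_c.
set L := run_bounds _ _ _ in fin_c *; set E := energy L lam in fin_c * => bound.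
have szL : size L = q by rewrite size_mkseq.
exists lam, E, (best L E).
case: (odd (size us')) bound => bound.
- exists (nth 0 (best L E) k'); split=> //; split=> //.
  by rewrite mem_nth // size_best szL.
- exists (nth 0 E k'); split=> //; split=> //.
  by rewrite mem_nth // size_map size_best szL.
Qed.

End Classes.

(** * Upper bounds *)

Section FromNat.
Variables (w : nat -> nat).
Hypothesis w_lt : forall n, w n < 3.
Let w3 (n : nat) : 'I_3 := inord (w n).

Lemma factor_val (u : seq 'I_3) : factor w3 u -> factor w (map val u).
Proof.
case=> p [n ->]; exists p, n; rewrite /mkseq -map_comp; apply: eq_map => j /=.
by rewrite inordK.
Qed.

Lemma RT_le_nat (R : realType) (i : nat) (r : R) :
  (forall (us : seq (seq nat)) q, size us = i -> (forall v, v \in us -> factor w v) ->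
     0 < q -> periodic q (flatten us) ->
     ((size (flatten us))%:R <= r * q%:R)%R) ->
  (RT R i 3 <= r%:E)%E.
Proof.
move=> wP; apply: (@RT_le _ _ _ _ w3) => us q szus facP q_gt0 per.
have -> : size (flatten us) = size (flatten (map (map val) us)).
  by rewrite -map_flatten size_map.
apply: wP => //; first by rewrite size_map.
- by move=> _ /mapP[u u_in ->]; apply/factor_val/facP.
- by rewrite -map_flatten; apply: periodic_map.
Qed.

End FromNat.

(** * The words with small exponents over 7 and over 3 letters *)

Definition code7 : seq (seq nat) :=
  mkseq (fun a => map (fun x => (x + a) %% 7) [:: 0; 3; 4; 5; 6; 2; 3; 4; 0]) 7.

Definition word7 : nat -> nat := fixed_point code7 9.

Definition pairs7 := Eval vm_compute in language 4 2 9 code7 [:: window word7 0 2].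
Definition factors7 := Eval vm_compute in language 4 5 9 code7 [:: window word7 0 5].

Lemma pairs7P p : window word7 p 2 \in pairs7.
Proof. by apply: closed_languageP; vm_compute. Qed.

Lemma factors7P p : window word7 p 5 \in factors7.
Proof. by apply: closed_languageP; vm_compute. Qed.

Lemma word7_lt n : word7 n < 7.
Proof. exact: (@fixed_point_lt code7 9). Qed.

Lemma word7_free p q e : 0 < q -> repeats word7 p q e -> 2 * e < q.
Proof.
move=> q_gt0 rep; rewrite ltnNge.
(* An excess below 8 + 5 with q <= 2e forces q <= 24, and 8 + 24 + 12 letters fit in five blocks of
   9. *)
apply: (@fixed_point_free code7 9 _ _ _ _ _ 5 5 pairs7 factors7 _ _ _ _ _ _ _
  (fun q e => q <= 2 * e) uphalf 24) rep.
all: try by vm_compute.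
- by move=> q' e'; lia.
- by move=> q' e1 e2; lia.
- by move=> q' e' _; lia.
- by move=> q' e' /=; lia.
Qed.

Definition dejean : seq (seq nat) :=
  [:: [:: 0; 1; 2; 0; 2; 1; 2; 0; 1; 2; 1; 0; 2; 1; 2; 0; 2; 1; 0];
      [:: 1; 2; 0; 1; 0; 2; 0; 1; 2; 0; 2; 1; 0; 2; 0; 1; 0; 2; 1];
      [:: 2; 0; 1; 2; 1; 0; 1; 2; 0; 1; 0; 2; 1; 0; 1; 2; 1; 0; 2]].

Definition dejean_word : nat -> nat := fixed_point dejean 19.

Definition dejean_pairs := Eval vm_compute in
  language 3 2 19 dejean [:: window dejean_word 0 2].
Definition dejean_factors := Eval vm_compute in
  language 3 4 19 dejean [:: window dejean_word 0 4].

Lemma dejean_free p q e : 0 < q -> repeats dejean_word p q e -> 4 * e <= 3 * q.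
Proof.
move=> q_gt0 rep; rewrite leqNgt.
(* An excess below 18 + 7 with 3q < 4e forces q <= 31, and 18 + 31 + 24 letters fit in four blocks
   of 19. *)
apply: (@fixed_point_free dejean 19 _ _ _ _ _ 7 4 dejean_pairs dejean_factors _ _ _ _ _ _ _
  (fun q e => 3 * q < 4 * e) (fun q => (3 * q) %/ 4 + 1) 31) rep.
all: try by vm_compute.
- by move=> q' e'; lia.
- by move=> q' e1 e2; lia.
- by move=> q' e' _; lia.
- by move=> q' e' /=; lia.
Qed.

Lemma RT1_le (R : realType) : (RT R 1 3 <= (7 / 4)%R%:E)%E.
Proof.
apply: (@RT_le_nat dejean_word) => [n | [|u [|? ?]] q //= _ facP q_gt0].
  exact: (@fixed_point_lt dejean 19).
rewrite cats0 => per; have [p [n def_u]] := facP u (mem_head _ _).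
suff le_n : 4 * size u <= 7 * q.
  by rewrite mulrAC ler_pdivlMr ?ltr0n // -!natrM ler_nat; lia.
have size_u : size u = n by rewrite def_u size_mkseq.
suff : 4 * (n - q) <= 3 * q by lia.
apply: (@dejean_free p) => // j lt_j.
have := periodic_nth 0 per (_ : q + j < size u).
rewrite size_u {1 2}def_u !nth_mkseq; [|lia..].
by rewrite addnA => -> //; lia.
Qed.

(* Both codes and the corresponding classes were found by computer search. *)
Definition code_even : seq (seq nat) :=
  [:: [:: 0; 2; 1; 2; 0; 1; 2; 1; 0; 1; 2; 0; 2; 1; 0; 1; 2; 1; 0; 2; 1; 2; 0; 1; 2; 1; 0; 1; 2;
          0; 2; 1; 2; 0; 1; 2; 1; 0; 2; 0; 1; 0; 2; 1; 2; 0; 1; 2; 1; 0; 2; 1; 2; 0; 1; 0; 2; 0;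
          1; 2; 1; 0; 1; 2; 0; 2; 1; 0; 1; 2; 1; 0; 2; 0; 1; 0; 2; 1; 2; 0; 1; 2; 1; 0; 1; 2; 0;
          2; 1; 2; 0; 1; 0; 2; 0; 1; 2; 1; 0; 2; 0; 1; 0; 2; 1; 2; 0; 2; 1; 0; 1; 2; 1; 0; 2; 1;
          2; 0; 1; 0; 2; 0; 1; 2; 1; 0; 1; 2; 0; 2; 1; 2; 0; 1; 2; 1; 0; 2; 0; 1];
      [:: 0; 2; 1; 2; 0; 1; 2; 1; 0; 1; 2; 0; 2; 1; 0; 1; 2; 1; 0; 2; 1; 2; 0; 1; 2; 1; 0; 1; 2;
          0; 2; 1; 2; 0; 1; 0; 2; 0; 1; 2; 1; 0; 2; 1; 2; 0; 2; 1; 0; 1; 2; 1; 0; 2; 0; 1; 0; 2;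
          1; 2; 0; 2; 1; 0; 1; 2; 1; 0; 2; 1; 2; 0; 1; 0; 2; 0; 1; 2; 1; 0; 2; 0; 1; 0; 2; 1; 2;
          0; 1; 0; 2; 0; 1; 2; 1; 0; 1; 2; 0; 2; 1; 0; 1; 2; 1; 0; 2; 1; 2; 0; 1; 2; 1; 0; 1; 2;
          0; 2; 1; 2; 0; 1; 2; 1; 0; 2; 1; 2; 0; 1; 0; 2; 0; 1; 2; 1; 0; 2; 0; 1];
      [:: 0; 2; 1; 2; 0; 1; 2; 1; 0; 1; 2; 0; 2; 1; 0; 1; 2; 1; 0; 2; 1; 2; 0; 1; 0; 2; 0; 1; 2;
          1; 0; 1; 2; 0; 2; 1; 2; 0; 1; 0; 2; 0; 1; 2; 1; 0; 2; 0; 1; 0; 2; 1; 2; 0; 2; 1; 0; 1;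
          2; 1; 0; 2; 1; 2; 0; 1; 2; 1; 0; 1; 2; 0; 2; 1; 2; 0; 1; 2; 1; 0; 2; 1; 2; 0; 1; 0; 2;
          0; 1; 2; 1; 0; 1; 2; 0; 2; 1; 0; 1; 2; 1; 0; 2; 0; 1; 0; 2; 1; 2; 0; 1; 2; 1; 0; 2; 1;
          2; 0; 2; 1; 0; 1; 2; 1; 0; 2; 1; 2; 0; 1; 0; 2; 0; 1; 2; 1; 0; 2; 0; 1];
      [:: 0; 2; 1; 2; 0; 1; 2; 1; 0; 1; 2; 0; 2; 1; 0; 1; 2; 1; 0; 2; 1; 2; 0; 1; 2; 1; 0; 1; 2;
          0; 2; 1; 2; 0; 1; 2; 1; 0; 2; 1; 2; 0; 2; 1; 0; 1; 2; 1; 0; 2; 0; 1; 0; 2; 1; 2; 0; 1;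
          0; 2; 0; 1; 2; 1; 0; 1; 2; 0; 2; 1; 2; 0; 1; 0; 2; 0; 1; 2; 1; 0; 2; 0; 1; 0; 2; 1; 2;
          0; 2; 1; 0; 1; 2; 1; 0; 2; 1; 2; 0; 1; 2; 1; 0; 1; 2; 0; 2; 1; 2; 0; 1; 2; 1; 0; 2; 1;
          2; 0; 1; 0; 2; 0; 1; 2; 1; 0; 2; 1; 2; 0; 2; 1; 0; 1; 2; 1; 0; 2; 0; 1];
      [:: 0; 2; 1; 2; 0; 1; 2; 1; 0; 1; 2; 0; 2; 1; 0; 1; 2; 1; 0; 2; 1; 2; 0; 1; 0; 2; 0; 1; 2;
          1; 0; 1; 2; 0; 2; 1; 2; 0; 1; 2; 1; 0; 2; 1; 2; 0; 2; 1; 0; 1; 2; 1; 0; 2; 0; 1; 0; 2;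
          1; 2; 0; 2; 1; 0; 1; 2; 1; 0; 2; 1; 2; 0; 1; 2; 1; 0; 1; 2; 0; 2; 1; 2; 0; 1; 2; 1; 0;
          2; 0; 1; 0; 2; 1; 2; 0; 1; 2; 1; 0; 2; 1; 2; 0; 2; 1; 0; 1; 2; 1; 0; 2; 1; 2; 0; 1; 0;
          2; 0; 1; 2; 1; 0; 1; 2; 0; 2; 1; 2; 0; 1; 0; 2; 0; 1; 2; 1; 0; 2; 0; 1];
      [:: 0; 2; 1; 2; 0; 1; 2; 1; 0; 1; 2; 0; 2; 1; 0; 1; 2; 1; 0; 2; 1; 2; 0; 1; 2; 1; 0; 1; 2;
          0; 2; 1; 2; 0; 1; 2; 1; 0; 2; 1; 2; 0; 1; 0; 2; 0; 1; 2; 1; 0; 2; 1; 2; 0; 2; 1; 0; 1;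
          2; 1; 0; 2; 0; 1; 0; 2; 1; 2; 0; 1; 2; 1; 0; 1; 2; 0; 2; 1; 2; 0; 1; 0; 2; 0; 1; 2; 1;
          0; 2; 0; 1; 0; 2; 1; 2; 0; 2; 1; 0; 1; 2; 1; 0; 2; 1; 2; 0; 1; 0; 2; 0; 1; 2; 1; 0; 1;
          2; 0; 2; 1; 2; 0; 1; 2; 1; 0; 2; 1; 2; 0; 2; 1; 0; 1; 2; 1; 0; 2; 0; 1];
      [:: 0; 2; 1; 2; 0; 1; 2; 1; 0; 1; 2; 0; 2; 1; 0; 1; 2; 1; 0; 2; 1; 2; 0; 1; 2; 1; 0; 1; 2;
          0; 2; 1; 2; 0; 1; 0; 2; 0; 1; 2; 1; 0; 2; 0; 1; 0; 2; 1; 2; 0; 1; 2; 1; 0; 2; 1; 2; 0;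
          2; 1; 0; 1; 2; 1; 0; 2; 1; 2; 0; 1; 0; 2; 0; 1; 2; 1; 0; 1; 2; 0; 2; 1; 2; 0; 1; 2; 1;
          0; 2; 0; 1; 0; 2; 1; 2; 0; 2; 1; 0; 1; 2; 1; 0; 2; 1; 2; 0; 1; 2; 1; 0; 1; 2; 0; 2; 1;
          2; 0; 1; 0; 2; 0; 1; 2; 1; 0; 2; 1; 2; 0; 2; 1; 0; 1; 2; 1; 0; 2; 0; 1]].

Definition code_odd : seq (seq nat) :=
  [:: [:: 2; 1; 2; 0; 1; 2; 1; 0; 2; 1; 2; 0; 1; 0; 2; 1; 0; 1; 2; 1; 0; 2; 0; 1; 0; 2; 1; 0; 1;
          2; 0; 1; 0; 2; 1; 2; 0; 2; 1; 0; 1; 2; 1; 0; 2; 0; 1; 0; 2; 1; 2; 0; 1; 2; 1; 0; 2; 1;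
          2; 0; 2; 1; 0; 1; 2; 1; 0; 2; 1; 2; 0; 1; 0; 2; 1; 0; 1; 2; 0; 1; 0; 2; 1; 2; 0; 1; 2;
          1; 0; 2; 0; 1; 0; 2; 1; 2; 0; 2; 1; 0; 1; 2; 0; 1; 0; 2; 1; 2; 0; 1; 2; 1; 0; 2; 0; 1;
          0; 2; 1; 0; 1; 2; 0; 1; 0; 2; 1; 2; 0; 2; 1; 0; 1; 2; 1; 0; 2; 1; 2; 0; 1; 0; 2; 1; 0;
          1; 2; 1; 0; 2; 0; 1; 0; 2; 1; 2; 0; 1; 2; 1; 0; 2; 1; 2; 0; 2; 1; 0; 1; 2; 1; 0; 2; 0;
          1; 0; 2; 1; 2; 0; 2; 1; 0; 1; 2; 0; 1; 0; 2; 1; 2; 0; 1; 2; 1; 0; 2; 1; 2; 0; 1; 0; 2;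
          1; 0; 1; 2; 0; 1; 0; 2; 1; 2; 0; 2; 1; 0; 1; 2; 1; 0; 2; 1; 2; 0; 1; 0; 2; 1; 0; 1; 2;
          0; 1; 0; 2; 1; 2; 0; 1; 2; 1; 0; 2; 0; 1; 0; 2; 1; 2; 0; 2; 1; 0; 1; 2; 0; 1; 0];
      [:: 2; 1; 2; 0; 1; 2; 1; 0; 2; 1; 2; 0; 2; 1; 0; 1; 2; 1; 0; 2; 0; 1; 0; 2; 1; 0; 1; 2; 0;
          1; 0; 2; 1; 2; 0; 2; 1; 0; 1; 2; 1; 0; 2; 0; 1; 0; 2; 1; 2; 0; 1; 2; 1; 0; 2; 1; 2; 0;
          1; 0; 2; 1; 0; 1; 2; 1; 0; 2; 0; 1; 0; 2; 1; 0; 1; 2; 0; 1; 0; 2; 1; 2; 0; 1; 2; 1; 0;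
          2; 0; 1; 0; 2; 1; 2; 0; 2; 1; 0; 1; 2; 1; 0; 2; 1; 2; 0; 1; 0; 2; 1; 0; 1; 2; 1; 0; 2;
          0; 1; 0; 2; 1; 2; 0; 1; 2; 1; 0; 2; 1; 2; 0; 2; 1; 0; 1; 2; 1; 0; 2; 0; 1; 0; 2; 1; 2;
          0; 2; 1; 0; 1; 2; 0; 1; 0; 2; 1; 2; 0; 1; 2; 1; 0; 2; 1; 2; 0; 1; 0; 2; 1; 0; 1; 2; 0;
          1; 0; 2; 1; 2; 0; 2; 1; 0; 1; 2; 1; 0; 2; 0; 1; 0; 2; 1; 2; 0; 1; 2; 1; 0; 2; 1; 2; 0;
          2; 1; 0; 1; 2; 1; 0; 2; 1; 2; 0; 1; 0; 2; 1; 0; 1; 2; 1; 0; 2; 0; 1; 0; 2; 1; 0; 1; 2;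
          0; 1; 0; 2; 1; 2; 0; 1; 2; 1; 0; 2; 0; 1; 0; 2; 1; 2; 0; 2; 1; 0; 1; 2; 0; 1; 0];
      [:: 2; 1; 2; 0; 1; 2; 1; 0; 2; 0; 1; 0; 2; 1; 0; 1; 2; 0; 1; 0; 2; 1; 2; 0; 2; 1; 0; 1; 2;
          1; 0; 2; 0; 1; 0; 2; 1; 2; 0; 1; 2; 1; 0; 2; 1; 2; 0; 2; 1; 0; 1; 2; 1; 0; 2; 0; 1; 0;
          2; 1; 2; 0; 2; 1; 0; 1; 2; 0; 1; 0; 2; 1; 2; 0; 1; 2; 1; 0; 2; 1; 2; 0; 1; 0; 2; 1; 0;
          1; 2; 1; 0; 2; 0; 1; 0; 2; 1; 0; 1; 2; 0; 1; 0; 2; 1; 2; 0; 2; 1; 0; 1; 2; 1; 0; 2; 1;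
          2; 0; 1; 0; 2; 1; 0; 1; 2; 0; 1; 0; 2; 1; 2; 0; 1; 2; 1; 0; 2; 0; 1; 0; 2; 1; 2; 0; 2;
          1; 0; 1; 2; 0; 1; 0; 2; 1; 2; 0; 1; 2; 1; 0; 2; 1; 2; 0; 1; 0; 2; 1; 0; 1; 2; 0; 1; 0;
          2; 1; 2; 0; 2; 1; 0; 1; 2; 1; 0; 2; 1; 2; 0; 1; 0; 2; 1; 0; 1; 2; 1; 0; 2; 0; 1; 0; 2;
          1; 2; 0; 1; 2; 1; 0; 2; 1; 2; 0; 1; 0; 2; 1; 0; 1; 2; 1; 0; 2; 0; 1; 0; 2; 1; 0; 1; 2;
          0; 1; 0; 2; 1; 2; 0; 1; 2; 1; 0; 2; 0; 1; 0; 2; 1; 2; 0; 2; 1; 0; 1; 2; 0; 1; 0];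
      [:: 2; 1; 2; 0; 1; 2; 1; 0; 2; 1; 2; 0; 2; 1; 0; 1; 2; 1; 0; 2; 1; 2; 0; 1; 0; 2; 1; 0; 1;
          2; 1; 0; 2; 0; 1; 0; 2; 1; 0; 1; 2; 0; 1; 0; 2; 1; 2; 0; 2; 1; 0; 1; 2; 1; 0; 2; 0; 1;
          0; 2; 1; 2; 0; 1; 2; 1; 0; 2; 1; 2; 0; 1; 0; 2; 1; 0; 1; 2; 0; 1; 0; 2; 1; 2; 0; 1; 2;
          1; 0; 2; 0; 1; 0; 2; 1; 2; 0; 2; 1; 0; 1; 2; 0; 1; 0; 2; 1; 2; 0; 1; 2; 1; 0; 2; 0; 1;
          0; 2; 1; 0; 1; 2; 0; 1; 0; 2; 1; 2; 0; 2; 1; 0; 1; 2; 1; 0; 2; 1; 2; 0; 1; 0; 2; 1; 0;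
          1; 2; 1; 0; 2; 0; 1; 0; 2; 1; 2; 0; 2; 1; 0; 1; 2; 0; 1; 0; 2; 1; 2; 0; 1; 2; 1; 0; 2;
          1; 2; 0; 1; 0; 2; 1; 0; 1; 2; 0; 1; 0; 2; 1; 2; 0; 2; 1; 0; 1; 2; 1; 0; 2; 0; 1; 0; 2;
          1; 2; 0; 1; 2; 1; 0; 2; 1; 2; 0; 2; 1; 0; 1; 2; 1; 0; 2; 1; 2; 0; 1; 0; 2; 1; 0; 1; 2;
          0; 1; 0; 2; 1; 2; 0; 1; 2; 1; 0; 2; 0; 1; 0; 2; 1; 2; 0; 2; 1; 0; 1; 2; 0; 1; 0];
      [:: 2; 1; 2; 0; 1; 2; 1; 0; 2; 1; 2; 0; 2; 1; 0; 1; 2; 1; 0; 2; 0; 1; 0; 2; 1; 0; 1; 2; 0;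
          1; 0; 2; 1; 2; 0; 2; 1; 0; 1; 2; 1; 0; 2; 0; 1; 0; 2; 1; 2; 0; 1; 2; 1; 0; 2; 1; 2; 0;
          1; 0; 2; 1; 0; 1; 2; 0; 1; 0; 2; 1; 2; 0; 1; 2; 1; 0; 2; 1; 2; 0; 2; 1; 0; 1; 2; 1; 0;
          2; 1; 2; 0; 1; 0; 2; 1; 0; 1; 2; 1; 0; 2; 0; 1; 0; 2; 1; 2; 0; 2; 1; 0; 1; 2; 0; 1; 0;
          2; 1; 2; 0; 1; 2; 1; 0; 2; 0; 1; 0; 2; 1; 0; 1; 2; 0; 1; 0; 2; 1; 2; 0; 2; 1; 0; 1; 2;
          1; 0; 2; 0; 1; 0; 2; 1; 2; 0; 1; 2; 1; 0; 2; 1; 2; 0; 1; 0; 2; 1; 0; 1; 2; 1; 0; 2; 0;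
          1; 0; 2; 1; 0; 1; 2; 0; 1; 0; 2; 1; 2; 0; 1; 2; 1; 0; 2; 0; 1; 0; 2; 1; 2; 0; 2; 1; 0;
          1; 2; 1; 0; 2; 1; 2; 0; 1; 0; 2; 1; 0; 1; 2; 1; 0; 2; 0; 1; 0; 2; 1; 2; 0; 1; 2; 1; 0;
          2; 1; 2; 0; 2; 1; 0; 1; 2; 1; 0; 2; 0; 1; 0; 2; 1; 2; 0; 2; 1; 0; 1; 2; 0; 1; 0];
      [:: 2; 1; 2; 0; 1; 2; 1; 0; 2; 0; 1; 0; 2; 1; 0; 1; 2; 0; 1; 0; 2; 1; 2; 0; 2; 1; 0; 1; 2;
          1; 0; 2; 0; 1; 0; 2; 1; 2; 0; 1; 2; 1; 0; 2; 1; 2; 0; 2; 1; 0; 1; 2; 1; 0; 2; 1; 2; 0;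
          1; 0; 2; 1; 0; 1; 2; 1; 0; 2; 0; 1; 0; 2; 1; 2; 0; 2; 1; 0; 1; 2; 0; 1; 0; 2; 1; 2; 0;
          1; 2; 1; 0; 2; 1; 2; 0; 2; 1; 0; 1; 2; 1; 0; 2; 0; 1; 0; 2; 1; 0; 1; 2; 0; 1; 0; 2; 1;
          2; 0; 2; 1; 0; 1; 2; 1; 0; 2; 1; 2; 0; 1; 0; 2; 1; 0; 1; 2; 1; 0; 2; 0; 1; 0; 2; 1; 2;
          0; 1; 2; 1; 0; 2; 1; 2; 0; 2; 1; 0; 1; 2; 1; 0; 2; 0; 1; 0; 2; 1; 2; 0; 2; 1; 0; 1; 2;
          0; 1; 0; 2; 1; 2; 0; 1; 2; 1; 0; 2; 1; 2; 0; 1; 0; 2; 1; 0; 1; 2; 1; 0; 2; 0; 1; 0; 2;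
          1; 0; 1; 2; 0; 1; 0; 2; 1; 2; 0; 2; 1; 0; 1; 2; 1; 0; 2; 1; 2; 0; 1; 0; 2; 1; 0; 1; 2;
          0; 1; 0; 2; 1; 2; 0; 1; 2; 1; 0; 2; 0; 1; 0; 2; 1; 2; 0; 2; 1; 0; 1; 2; 0; 1; 0];
      [:: 2; 1; 2; 0; 1; 2; 1; 0; 2; 0; 1; 0; 2; 1; 0; 1; 2; 0; 1; 0; 2; 1; 2; 0; 2; 1; 0; 1; 2;
          1; 0; 2; 0; 1; 0; 2; 1; 2; 0; 1; 2; 1; 0; 2; 1; 2; 0; 1; 0; 2; 1; 0; 1; 2; 0; 1; 0; 2;
          1; 2; 0; 1; 2; 1; 0; 2; 0; 1; 0; 2; 1; 2; 0; 2; 1; 0; 1; 2; 1; 0; 2; 1; 2; 0; 1; 0; 2;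
          1; 0; 1; 2; 1; 0; 2; 0; 1; 0; 2; 1; 2; 0; 1; 2; 1; 0; 2; 1; 2; 0; 1; 0; 2; 1; 0; 1; 2;
          1; 0; 2; 0; 1; 0; 2; 1; 0; 1; 2; 0; 1; 0; 2; 1; 2; 0; 1; 2; 1; 0; 2; 0; 1; 0; 2; 1; 2;
          0; 2; 1; 0; 1; 2; 0; 1; 0; 2; 1; 2; 0; 1; 2; 1; 0; 2; 1; 2; 0; 2; 1; 0; 1; 2; 1; 0; 2;
          0; 1; 0; 2; 1; 0; 1; 2; 0; 1; 0; 2; 1; 2; 0; 2; 1; 0; 1; 2; 1; 0; 2; 1; 2; 0; 1; 0; 2;
          1; 0; 1; 2; 1; 0; 2; 0; 1; 0; 2; 1; 2; 0; 1; 2; 1; 0; 2; 1; 2; 0; 1; 0; 2; 1; 0; 1; 2;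
          0; 1; 0; 2; 1; 2; 0; 1; 2; 1; 0; 2; 0; 1; 0; 2; 1; 2; 0; 2; 1; 0; 1; 2; 0; 1; 0]].

Definition classes_even : seq (seq nat * nat) :=
  [:: ([:: 0; 1; 2], 9);
      ([:: 0; 2; 1], 9);
      ([:: 0; 1; 0; 2], 12);
      ([:: 0; 1; 2; 1], 12);
      ([:: 0; 2; 1; 2], 12);
      ([:: 0; 1; 0; 2; 1; 2], 12);
      ([:: 0; 1; 2; 0; 2; 1], 12);
      ([:: 0; 1; 2; 1; 0; 2], 12);
      ([:: 0; 1; 2; 1; 0; 2; 1; 2], 24);
      ([:: 0; 1; 2; 0; 2; 1; 2; 0; 1; 2; 1], 22);
      ([:: 0; 1; 2; 1; 0; 2; 1; 2; 0; 2; 1], 22);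
      ([:: 0; 1; 0; 2; 0; 1; 2; 1; 0; 2; 1; 2], 24);
      ([:: 0; 1; 0; 2; 1; 2; 0; 1; 2; 1; 0; 2], 24);
      ([:: 0; 1; 0; 2; 0; 1; 2; 1; 0; 1; 2; 0; 2; 1; 2], 30);
      ([:: 0; 1; 0; 2; 1; 2; 0; 2; 1; 0; 1; 2; 1; 0; 2], 30);
      ([:: 0; 1; 0; 2; 0; 1; 2; 1; 0; 2; 0; 1; 0; 2; 1; 2], 32);
      ([:: 0; 1; 2; 0; 2; 1; 0; 1; 2; 1; 0; 2; 1; 2; 0; 1; 2; 1], 36);
      ([:: 0; 1; 2; 0; 2; 1; 2; 0; 1; 2; 1; 0; 2; 1; 2; 0; 1; 2; 1], 38)].

Definition classes_odd : seq (seq nat * nat) :=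
  [:: ([:: 0; 1; 2], 9);
      ([:: 0; 2; 1], 9);
      ([:: 0; 1; 0; 2], 8);
      ([:: 0; 1; 2; 1], 8);
      ([:: 0; 2; 1; 2], 8);
      ([:: 0; 1; 0; 2; 1; 2], 18);
      ([:: 0; 1; 0; 2; 1; 0; 1; 2], 16);
      ([:: 0; 1; 2; 1; 0; 2; 1; 2], 16);
      ([:: 0; 1; 0; 2; 1; 0; 1; 2; 1; 0; 2], 22);
      ([:: 0; 1; 2; 1; 0; 2; 1; 2; 0; 2; 1], 22);
      ([:: 0; 1; 0; 2; 1; 2; 0; 1; 2; 1; 0; 2], 36);
      ([:: 0; 1; 0; 2; 1; 2; 0; 2; 1; 0; 1; 2], 36);
      ([:: 0; 1; 0; 2; 1; 0; 1; 2; 1; 0; 2; 1; 2], 26);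
      ([:: 0; 1; 0; 2; 1; 2; 0; 2; 1; 0; 1; 2; 1; 0; 2], 42);
      ([:: 0; 1; 0; 2; 1; 0; 1; 2; 0; 1; 0; 2; 1; 2; 0; 1; 2; 1; 0; 2], 60);
      ([:: 0; 1; 0; 2; 1; 2; 0; 1; 2; 1; 0; 2; 1; 2; 0; 2; 1; 0; 1; 2], 40);
      ([:: 0; 1; 0; 2; 1; 0; 1; 2; 0; 1; 0; 2; 1; 2; 0; 1; 2; 1; 0; 2; 1; 2], 44);
      ([:: 0; 1; 0; 2; 1; 0; 1; 2; 0; 1; 0; 2; 1; 2; 0; 2; 1; 0; 1; 2; 1; 0; 2], 46);
      ([:: 0; 1; 0; 2; 1; 2; 0; 1; 2; 1; 0; 2; 1; 2; 0; 2; 1; 0; 1; 2; 1; 0; 2], 46);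
      ([:: 0; 1; 0; 2; 1; 2; 0; 1; 2; 1; 0; 2; 0; 1; 0; 2; 1; 2; 0; 2; 1; 0; 1; 2], 48);
      ([:: 0; 1; 0; 2; 1; 0; 1; 2; 0; 1; 0; 2; 1; 2; 0; 2; 1; 0; 1; 2; 1; 0; 2; 1; 2], 50);
      ([:: 0; 1; 0; 2; 1; 0; 1; 2; 1; 0; 2; 0; 1; 0; 2; 1; 2; 0; 1; 2; 1; 0; 2; 1; 2], 50)].

(** * Products of factors of the coded words *)

Section Coding.
Variables (code : seq (seq nat)) (m L cp cs qmax : nat).
Variable classes : seq (seq nat * nat).
Variable final : nat -> nat -> seq nat -> seq nat -> bool.
Hypotheses (m_gt0 : 0 < m) (code_m : uniform m code) (code_size : size code = 7).
Hypotheses (L_gt0 : 0 < L) (le_Lm : L <= m) (cp_lt : cp < m) (cs_lt : cs < m).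
Hypotheses (cpP : prefixes_differ cp code) (csP : suffixes_differ m cs code).
Hypothesis syncP : synchronizing m L code pairs7.
Hypothesis le_c : 2 * (cp + cs) <= m.
Hypotheses (le_qmax : 2 * (m.-1 + L) <= qmax + 3) (le_qm : m + qmax + qmax./2 <= 5 * m).
Hypothesis scanP :
  scan_all m qmax (fun q => q./2.+1) (in_class classes) (map (flat code) factors7).
Hypothesis classesP : all (class_ok m (map (flat code) pairs7) final) classes.
Hypothesis code_lt : all (all (gtn 3)) code.

Definition coded : nat -> nat := image code m word7.

Let word_lt n : word7 n < size code.
Proof. by rewrite code_size word7_lt. Qed.

Lemma coded_lt n : coded n < 3.
Proof.
have lt_a := word_lt (n %/ m).
apply: (allP (allP code_lt _ (mem_nth [::] lt_a))); apply: mem_nth.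
by rewrite (eqP (allP code_m _ (mem_nth _ lt_a))) ltn_mod.
Qed.

(** If the excess is long, q = q0 m and 2 e0 < q0, so 2e <= (q0 - 1)m + 2(cp + cs) <= q by [le_c]:
    the strict bound on [word7] pays for both partial blocks. Otherwise q <= 2(m - 1 + L) - 3 <=
    [qmax], and the scan applies with q/2 + 1, the least excess allowed. *)
Lemma coded_runs p q e : 0 < q -> q < 2 * e -> repeats coded p q e ->
  in_class classes (window coded p q).
Proof.
move=> q_gt0 lt_qe rep; case: (leqP (m.-1 + L) e) => [le_e | lt_e].
  have [q0 [t [e0 [def_q rep0 le_e0]]]] := desubstitute m_gt0 code_m word_lt L_gt0 le_Lm
    cp_lt cs_lt pairs7P cpP csP syncP rep le_e.
  have q0_gt0 : 0 < q0 by case: (q0) def_q q_gt0 => // ->.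
  by have := word7_free q0_gt0 rep0; nia.
apply: (scan_image m_gt0 code_m word_lt factors7P scanP); [lia | lia |].
by move=> j lt_j; apply: rep; lia.
Qed.

Lemma coded_products (us : seq (seq nat)) q : 0 < q ->
  (forall u, u \in us -> factor coded u) -> periodic q (flatten us) ->
  2 * size (flatten us) <= 3 * q * size us \/
  exists lam E G x, final q lam E G /\
    if odd (size us) then x \in G /\ 2 * size (flatten us) + lam <= lam * size us + x
    else x \in E /\ 2 * size (flatten us) <= lam * size us + x.
Proof. exact: (product_cases m_gt0 code_m word_lt pairs7P classesP coded_runs). Qed.

End Coding.

(** The second condition is the bound 13q/4 for two factors; [lam <= 3 * q] covers each further
    pair. *)
Definition final_even (q lam : nat) (E G : seq nat) : bool :=
  (lam <= 3 * q) && all (fun x => 4 * lam + 2 * x <= 13 * q) E.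

(** The second condition is the bound 14q/3 for three factors, the smallest odd case treated; each
    further pair adds at most 3q. *)
Definition final_odd (q lam : nat) (E G : seq nat) : bool :=
  (lam <= 3 * q) && all (fun x => 6 * lam + 3 * x <= 28 * q) G.

Lemma scan_even : scan_all 140 305 (fun q => q./2.+1) (in_class classes_even)
  (map (flat code_even) factors7).
Proof. by vm_cast_no_check (erefl true). Qed.

Lemma scan_odd : scan_all 259 623 (fun q => q./2.+1) (in_class classes_odd)
  (map (flat code_odd) factors7).
Proof. by vm_cast_no_check (erefl true). Qed.

Lemma classes_evenP : all (class_ok 140 (map (flat code_even) pairs7) final_even) classes_even.
Proof. by vm_cast_no_check (erefl true). Qed.

Lemma classes_oddP : all (class_ok 259 (map (flat code_odd) pairs7) final_odd) classes_odd.
Proof. by vm_cast_no_check (erefl true). Qed.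

Lemma RT_even_le (R : realType) i : 0 < i -> ~~ odd i ->
  (RT R i 3 <= (3 * i%:R / 2 + 1 / 4)%R%:E)%E.
Proof.
move=> i_gt0 even_i; apply: (@RT_le_nat (coded code_even 140)) => [n | us q szus facP q_gt0 per].
  by apply: coded_lt => //; vm_cast_no_check (erefl true).
suff : 4 * size (flatten us) <= q * (6 * i + 1).
  by rewrite -(ler_nat R) !natrM natrD natrM => ?; nra.
(* The cut-off 305 is 2(139 + 15) - 3, and 43 + 27 is exactly half of 140. *)
have [] := @coded_products code_even 140 15 43 27 305 classes_even final_even
  _ _ _ _ _ _ _ _ _ _ _ _ _ scan_even classes_evenP _ us q q_gt0 facP per.
all: try by vm_compute.
- by rewrite szus; nia.
- rewrite szus (negbTE even_i) => -[lam [E [G [x [/andP[le_lam /allP EP] [/EP le_x le_s]]]]]].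
  pose j := i./2.-1; have def_i : i = j * 2 + 2 by rewrite /j; lia.
  by move: le_s; rewrite def_i; nia.
Qed.

Lemma RT_odd_le (R : realType) i : 3 <= i -> odd i ->
  (RT R i 3 <= (3 * i%:R / 2 + 1 / 6)%R%:E)%E.
Proof.
move=> i_ge3 odd_i; apply: (@RT_le_nat (coded code_odd 259)) => [n | us q szus facP q_gt0 per].
  by apply: coded_lt => //; vm_cast_no_check (erefl true).
suff : 6 * size (flatten us) <= q * (9 * i + 1).
  by rewrite -(ler_nat R) !natrM natrD natrM => ?; nra.
have [] := @coded_products code_odd 259 55 65 61 623 classes_odd final_odd
  _ _ _ _ _ _ _ _ _ _ _ _ _ scan_odd classes_oddP _ us q q_gt0 facP per.
all: try by vm_compute.
- by rewrite szus; nia.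
- rewrite szus odd_i => -[lam [E [G [x [/andP[le_lam /allP GP] [/GP le_x le_s]]]]]].
  pose j := i./2.-1; have def_i : i = j * 2 + 3 by rewrite /j; lia.
  by move: le_s; rewrite def_i; nia.
Qed.

Local Open Scope ring_scope.

Theorem theorem3 (R : realType) (i : nat) (hi : (1 <= i)%N) :
  (i = 1%N \/ ~~ odd i -> RT R i 3 = (3 * i%:R / 2 + 1 / 4)%:E) /\
  (odd i /\ (3 <= i)%N -> RT R i 3 = (3 * i%:R / 2 + 1 / 6)%:E).
Proof.
split=> [[-> | even_i] | [odd_i i_ge3]]; apply/eqP; rewrite eq_le.
- have -> : 3 * 1%:R / 2 + 1 / 4 = 7 / 4 :> R by lra.
  by rewrite RT1_ge RT1_le.
- by rewrite RT_even_ge // RT_even_le.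
- by rewrite RT_odd_ge // RT_odd_le.
Qed.
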